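(* Let $d\ge1$, let $\square^d=[-1,1]^d$, and let $\mu$ be the equilibrium measure of $\square^d$, i.e. the probability measure on $\square^d$ proportional to $$\frac{dx}{\sqrt{1-x_1^2}\cdots\sqrt{1-x_d^2}}.$$ For $\varepsilon\in\{0,1\}^d$ let $|\varepsilon|=\sum_{j=1}^d\varepsilon_j$ and $g_\varepsilon(x)=\prod_{j=1}^d(1-x_j^2)^{\varepsilon_j}$, $x\in\mathbb{R}^d$, and let $g_\varepsilon\cdot\mu$ be the (not normalized) measure $g_\varepsilon\,d\mu$ on $\square^d$. Then for every $m\in\mathbb{N}$ and $x\in\mathbb{R}^d$, $$\sum_{\varepsilon\in\{0,1\}^d;\ |\varepsilon|\le m} g_\varepsilon(x)\,P^{g_\varepsilon\cdot\mu}_{m-|\varepsilon|}(x,x)=\sum_{j=0}^d\binom{d}{j}\left[\binom{d+m-j}{d}-\binom{d+m-1-j}{d}\right],$$ and, as a consequence, for every $n\in\mathbb{N}$, $$\sum_{\varepsilon\in\{0,1\}^d;\ |\varepsilon|\le n} g_\varepsilon(x)\,\Lambda^{g_\varepsilon\cdot\mu}_{n-|\varepsilon|}(x)^{-1}=\sum_{j=0}^d\binom{d}{j}\binom{d+n-j}{d},\qquad\forall x\in\mathbb{R}^d.$$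
   Context: $\mathbb{N}=\{0,1,2,\dots\}$; $\mathbb{R}[x]_n$ is the space of real polynomials in $x=(x_1,\dots,x_d)$ of total degree at most $n$. For a finite nonnegative Borel measure $\nu$ (not necessarily a probability measure) with compact support and $\int p^2\,d\nu>0$ for all nonzero polynomials $p$, let $\mathcal{V}_m$ be the space of polynomials of degree $m$ orthogonal in $L^2(\nu)$ to all polynomials of degree less than $m$ (together with $0$). For any orthonormal basis $(P_\alpha)_{|\alpha|=m}$ of $\mathcal{V}_m$ in $L^2(\nu)$, $P^\nu_m(x,y)=\sum_{|\alpha|=m}P_\alpha(x)P_\alpha(y)$, the reproducing kernel of $\mathcal V_m$ (independent of the basis). The Christoffel function is $\Lambda^\nu_n(\xi)=\inf\{\int p^2\,d\nu: p\in\mathbb{R}[x]_n,\ p(\xi)=1\}$; equivalently $\Lambda^\nu_n(x)^{-1}=\sum_{m=0}^n P^\nu_m(x,x)$ for all $x\in\mathbb{R}^d$. Convention: $\binom{a}{b}=0$ whenever $a<b$ (including negative $a$). *)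

(* Defs.v *)
From HB Require Import structures.
From mathcomp Require Import all_boot all_order all_algebra.
(* The notations of multinomials clash with those of MathComp-Analysis. *)
From mathcomp Require Import -(notations) mpoly.
From mathcomp Require Import all_classical all_reals all_analysis.
From mathcomp Require Import measurable_realfun.
From mathcomp Require Import lra.

Set Implicit Arguments.
Unset Strict Implicit.
Unset Printing Implicit Defensive.

Import Order.TTheory GRing.Theory Num.Theory.

Local Open Scope classical_set_scope.
Local Open Scope ring_scope.

Notation "{ 'mpoly' R [ d ] }" := (mpoly d R) (at level 0, R, d at level 2).
(* msize p is the total degree plus one, and msize 0 = 0. *)
Notation msize p := (mmeasure mdeg p).

(* R^d as tuples: its sigma-algebra is the product of the Borel ones. *)
Notation Rd R d := (d.-tuple (measurableTypeR R)).

(* The measure with density f with respect to mu, concentrated on D. *)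
Section density.
Local Open Scope ereal_scope.
Context {disp : measure_display} {T : measurableType disp} {R : realType}.

Definition with_density (mu : {measure set T -> \bar R}) (D : set T)
    (f : T -> R) : set T -> \bar R :=
  fun A => \int[mu]_(x in A `&` D) (f x)%:E.

Variables (mu : {measure set T -> \bar R}) (D : set T) (f : T -> R).
Hypothesis f_ge0 : forall x, D x -> (0 <= f x)%R.

Lemma with_density0 : with_density mu D f set0 = 0.
Proof. by rewrite /with_density set0I integral_set0. Qed.

Lemma with_density_ge0 A : 0 <= with_density mu D f A.
Proof. by apply: integral_ge0 => x [_ Dx]; rewrite lee_fin f_ge0. Qed.

Lemma with_density_sigma_additive :
  measurable D -> measurable_fun D f ->
  semi_sigma_additive (with_density mu D f).
Proof.
move=> mD mf F mF tF mUF; rewrite /with_density setI_bigcupl.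
rewrite ge0_integral_bigcup//=.
- apply: is_cvg_ereal_nneg_natsum_cond => n _ _.
  exact: with_density_ge0.
- by move=> i; exact: measurableI.
- rewrite -setI_bigcupl; apply: (@measurable_funS _ _ _ _ D) => //.
  exact/measurable_EFinP.
- by move=> x [i _ [_ Dx]]; rewrite lee_fin f_ge0.
- apply/trivIsetP => i j _ _ ij; rewrite setIACA.
  by move/trivIsetP : tF => /(_ i j I I ij) ->; rewrite set0I.
Qed.

End density.

Section lebesgue_cons.
Local Open Scope ereal_scope.
Context {R : realType} (n : nat).
Variable m : {sigma_finite_measure set (Rd R n) -> \bar R}.

Definition tuple_cons (p : measurableTypeR R * Rd R n) : Rd R n.+1 :=
  [tuple of p.1 :: p.2].

Lemma measurable_tuple_cons : measurable_fun setT tuple_cons.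
Proof. exact: measurable_cons. Qed.

Definition lebesgue_cons : set (Rd R n.+1) -> \bar R :=
  pushforward (lebesgue_measure \x m) tuple_cons.

Let lebesgue_cons0 : lebesgue_cons set0 = 0.
Proof. by have mc := measurable_tuple_cons; exact: measure0. Qed.

Let lebesgue_cons_ge0 A : 0 <= lebesgue_cons A.
Proof. by have mc := measurable_tuple_cons; exact: measure_ge0. Qed.

Let lebesgue_cons_sigma_additive : semi_sigma_additive lebesgue_cons.
Proof. by have mc := measurable_tuple_cons; exact: measure_semi_sigma_additive. Qed.

HB.instance Definition _ := isMeasure.Build _ _ _ lebesgue_cons
  lebesgue_cons0 lebesgue_cons_ge0 lebesgue_cons_sigma_additive.

Lemma lebesgue_cons_box (A : set (measurableTypeR R)) (B : set (Rd R n)) :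
  measurable A -> measurable B ->
  lebesgue_cons [set x | A (thead x) /\ B [tuple of behead x]] =
  lebesgue_measure A * m B.
Proof.
move=> mA mB; rewrite -product_measure1E//; congr (_ \x _).
apply/seteqP; split=> -[a t]; rewrite /tuple_cons /=.
  by move=> []; rewrite theadE => ?; rewrite (_ : [tuple of _] = t)//;
    exact: val_inj.
by move=> [? ?]; split; rewrite ?theadE// (_ : [tuple of _] = t)//;
  exact: val_inj.
Qed.

Let lebesgue_cons_sigma_finite : sigma_finite setT lebesgue_cons.
Proof.
have /sigma_finiteP[F [TF ndF Foo]] := sigma_finiteT (@lebesgue_measure R).
have /sigma_finiteP[G [TG ndG Goo]] := sigma_finiteT m.
exists (fun k => [set x | F k (thead x) /\ G k [tuple of behead x]]).
  apply/seteqP; split=> // x _.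
  have [i _ Fi] : (\bigcup_i F i) (thead x) by rewrite -TF.
  have [j _ Gj] : (\bigcup_i G i) [tuple of behead x] by rewrite -TG.
  exists (maxn i j) => //; split.
  - by move: Fi; exact/subsetPset/ndF/leq_maxl.
  - by move: Gj; exact/subsetPset/ndG/leq_maxr.
move=> k; have [mF Fk] := Foo k; have [mG Gk] := Goo k; split.
- apply: measurableI.
  + rewrite -[X in measurable X]setTI.
    exact: (measurable_tnth ord0 measurableT mF).
  + rewrite -[X in measurable X]setTI.
    exact: (@measurable_behead _ _ n measurableT _ mG).
- by rewrite lebesgue_cons_box// lte_mul_pinfty// ge0_fin_numE.
Qed.

HB.instance Definition _ := Measure_isSigmaFinite.Build _ _ _ lebesgue_cons
  lebesgue_cons_sigma_finite.

End lebesgue_cons.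

(* Lebesgue measure on R^d, as the d-fold product of the one on R. *)
Fixpoint lebesgue_tuple (R : realType) (d : nat) :
    {sigma_finite_measure set (Rd R d) -> \bar R} :=
  match d with
  | 0 => \d_([tuple] : Rd R 0)
  | d'.+1 => lebesgue_cons (lebesgue_tuple R d')
  end.

Section equilibrium.
Context {R : realType} (d : nat).
Implicit Types x : Rd R d.

Definition cube : set (Rd R d) := [set x | forall i, -1 <= tnth x i <= 1].

Lemma measurable_cube : measurable cube.
Proof.
rewrite (_ : cube = \bigcap_(i in [set: 'I_d])
    ((fun x => tnth x i) @^-1` `[-1, 1])); last first.
  apply/seteqP; split=> x /= cx i; first by move=> _; rewrite /= in_itv/=; exact: cx.
  by have := cx i I; rewrite /= in_itv.
apply: fin_bigcap_measurable => // i _; rewrite -[X in measurable X]setTI.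
exact: measurable_tnth.
Qed.

(* Both conventions for 1 / sqrt 0 give the same measure: the faces of the cube
   are negligible. *)
Definition arcsine_weight x : R :=
  \prod_(i < d) (Num.sqrt (1 - tnth x i ^+ 2))^-1.

Lemma arcsine_weight_ge0 x : 0 <= arcsine_weight x.
Proof. by apply: prodr_ge0 => i _; rewrite invr_ge0 sqrtr_ge0. Qed.

Lemma one_sub_sqr_ge0 x i : cube x -> 0 <= 1 - tnth x i ^+ 2.
Proof. by move=> /(_ i) /andP[? ?]; nra. Qed.

Lemma measurable_one_sub_sqr i :
  measurable_fun setT (fun x => 1 - tnth x i ^+ 2).
Proof.
apply: measurable_funB => //; apply: measurable_funX.
exact: measurable_tnth.
Qed.

Lemma measurable_arcsine_weight : measurable_fun cube arcsine_weight.
Proof.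
apply: measurable_prod => i _.
apply: (eq_measurable_fun (fun x => (1 - tnth x i ^+ 2) `^ (- 2^-1))).
  move=> x; rewrite inE => cx.
  by rewrite powRN powR12_sqrt// one_sub_sqr_ge0.
apply: measurable_funTS.
apply: (measurableT_comp (measurable_powR _)).
exact: measurable_one_sub_sqr.
Qed.

Definition arcsine_measure : set (Rd R d) -> \bar R :=
  with_density (lebesgue_tuple R d) cube arcsine_weight.

HB.instance Definition _ := isMeasure.Build _ _ _ arcsine_measure
  (with_density0 _ _ _)
  (with_density_ge0 _ (fun x _ => arcsine_weight_ge0 x))
  (with_density_sigma_additive (fun x _ => arcsine_weight_ge0 x)
    measurable_cube measurable_arcsine_weight).

(* The second argument of mnormalize is only its value on measures that cannot
   be normalized. *)
Definition equilibrium : probability (Rd R d) R :=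
  mnormalize arcsine_measure (\d_([tuple 0 | i < d] : Rd R d)).

Definition cube_weight (eps : {ffun 'I_d -> bool}) x : R :=
  \prod_(i < d) (1 - tnth x i ^+ 2) ^+ eps i.

Lemma cube_weight_ge0 eps x : cube x -> 0 <= cube_weight eps x.
Proof.
by move=> cx; apply: prodr_ge0 => i _; rewrite exprn_ge0// one_sub_sqr_ge0.
Qed.

Lemma measurable_cube_weight eps : measurable_fun cube (cube_weight eps).
Proof.
apply: measurable_prod => i _; apply: measurable_funTS.
by apply: measurable_funX; exact: measurable_one_sub_sqr.
Qed.

(* Restricting to the cube changes nothing, as equilibrium does not charge its
   complement, and makes the density nonnegative. *)
Definition weighted_equilibrium (eps : {ffun 'I_d -> bool}) :
    set (Rd R d) -> \bar R :=
  with_density equilibrium cube (cube_weight eps).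

HB.instance Definition _ eps := isMeasure.Build _ _ _ (weighted_equilibrium eps)
  (with_density0 _ _ _)
  (with_density_ge0 _ (cube_weight_ge0 eps))
  (with_density_sigma_additive (cube_weight_ge0 eps)
    measurable_cube (measurable_cube_weight eps)).

End equilibrium.

Section christoffel.
Context {R : realType} {d : nat}.
Variable nu : {measure set (Rd R d) -> \bar R}.
Implicit Types (p q : {mpoly R[d]}) (x y : Rd R d).

Definition peval p x : R := meval (tnth x) p.

Definition L2dot p q : R := \int[nu]_x (peval p x * peval q x).

Definition orthopoly (m : nat) : set {mpoly R[d]} :=
  [set p | p = 0 \/
    msize p = m.+1 /\ forall q, (msize q <= m)%N -> L2dot p q = 0].

(* The family is indexed by the multi-indices a with mdeg a = m; its values at
   the indices of smaller degree are irrelevant. *)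
Definition orthonormal_basis (m : nat)
    (P : {ffun bmultinom d m.+1 -> {mpoly R[d]}}) : Prop :=
  [/\ forall a : bmultinom d m.+1, mdeg a = m -> orthopoly m (P a),
      forall a b : bmultinom d m.+1,
        mdeg a = m -> mdeg b = m -> L2dot (P a) (P b) = (a == b)%:R
    & forall p, orthopoly m p -> exists c : bmultinom d m.+1 -> R,
        p = \sum_(a : bmultinom d m.+1 | mdeg a == m) c a *: P a].

(* The value does not depend on the basis P that xget picks. *)
Definition repr_kernel (m : nat) x y : R :=
  let P := xget [ffun=> 0] [set P | @orthonormal_basis m P] in
  \sum_(a : bmultinom d m.+1 | mdeg a == m) peval (P a) x * peval (P a) y.

Definition christoffel (n : nat) x : R :=
  inf [set L2dot p p | p in [set p | (msize p <= n.+1)%N /\ peval p x = 1]].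

End christoffel.

(* Main.v *)
Require Import Defs.
From HB Require Import structures.
From mathcomp Require Import all_boot all_order all_algebra.
From mathcomp Require Import -(notations) mpoly.
From mathcomp Require Import all_classical all_reals all_analysis.
From mathcomp Require Import measurable_realfun.
From mathcomp Require Import zify ring lra.
Import Order.TTheory GRing.Theory Num.Theory.
Local Open Scope ring_scope.
Set Implicit Arguments.
Unset Strict Implicit.
Unset Printing Implicit Defensive.

(** The theorem is the identity cos^2 + sin^2 = 1, multiplied over the
    coordinates and sorted by degree.

    Write T_k(cos t) = cos (k t) and V_k(cos t) = sin (k t) / sin t for the
    Chebyshev polynomials, so that T_k^2 + (1 - X^2) V_k^2 = 1 (cheb_pell). The
    polynomials 1, sqrt 2 T_k (k > 0) are orthonormal for the arcsine law on
    [-1, 1], and the polynomials sqrt 2 V_(k+1) are orthonormal for 1 - X^2 times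
    that law. Their products over the coordinates, the weighted_cheb eps a with
    |a| = k, are orthonormal for the measure g_eps mu and form a basis of its
    orthogonal polynomials of degree k. As the kernel does not depend on the
    basis, g_eps(x) P_k(x, x) is the sum over |a| = k of products over i of terms
    f_i(eps_i, a_i), where f_i(0, 0) = 1 and, for k > 0,
    f_i(0, k) = 2 T_k(x_i)^2 and f_i(1, k - 1) = 2 (1 - x_i^2) V_k(x_i)^2.

    Summing over eps and over |a| = m - |eps|, and putting b = a + eps, gives the
    sum over |b| = m of the products over i of f_i(0, b_i) + f_i(1, b_i - 1),
    without the second term if b_i = 0 (sum_eps_mnms). By the identity above each
    factor is 1 if b_i = 0 and 2 otherwise, whatever x is. These are also the
    factors that one gets from f_i = 1, so the sum is the number of pairs (eps, a)
    with |eps| + |a| = m (eq_sum_eps_mnms), which is the right-hand side, sorted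
    by j = |eps|.

    For the Christoffel function, Cauchy-Schwarz in the orthonormal basis gives
    that its inverse is the sum of the kernels of degree at most n (christoffelE),
    so the second identity is the sum of the first ones over m <= n, where the
    binomial coefficients telescope.

    Orthonormality comes from integration alone. The weight
    w = 1 / sqrt (1 - t^2) satisfies ((1 - t^2) w)' = - t w, hence
    (1 - X^2) p' - X p has integral 0 against w for each polynomial p
    (arcsine_int_deriv). As (1 - X^2) V_k' - X V_k = - k T_k, this kills the
    integral of T_k for k > 0, and the product formulas for cosines and sines do
    the rest. The passage to R^d is Fubini's theorem for products of functions of
    one variable (lebesgue_tuple_prod). *)

(** * Chebyshev polynomials *)

Section chebyshev.
Variable R : comNzRingType.

(** The pair (T_k, U_(k-1)) of Chebyshev polynomials of the first and second
    kind. The recurrence is the angle addition formula for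
    T_k(cos t) = cos (k t) and U_(k-1)(cos t) = sin (k t) / sin t; shifting the
    index of the second kind makes both components start at an angle 0. *)
Fixpoint cheb k : {poly R} * {poly R} :=
  if k is k'.+1 then
    let: (t, v) := cheb k' in ('X * t - (1 - 'X ^+ 2) * v, 'X * v + t)
  else (1, 0).

Definition chebT k := (cheb k).1.
Definition chebV k := (cheb k).2.

Lemma chebT0 : chebT 0 = 1. Proof. by []. Qed.
Lemma chebV0 : chebV 0 = 0. Proof. by []. Qed.

Lemma chebTS k : chebT k.+1 = 'X * chebT k - (1 - 'X ^+ 2) * chebV k.
Proof. by rewrite /chebT /chebV /=; case: (cheb k). Qed.

Lemma chebVS k : chebV k.+1 = 'X * chebV k + chebT k.
Proof. by rewrite /chebT /chebV /=; case: (cheb k). Qed.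

Lemma chebV1 : chebV 1 = 1.
Proof. by rewrite chebVS chebV0 chebT0 mulr0 add0r. Qed.

(** This is cos^2 + sin^2 = 1; the only property of the value at x that enters
    the sum of the kernels. *)
Lemma cheb_pell k : chebT k ^+ 2 + (1 - 'X ^+ 2) * chebV k ^+ 2 = 1.
Proof.
elim: k => [|k IH]; first by rewrite chebT0 chebV0; ring.
rewrite -[RHS]IH chebTS chebVS; ring.
Qed.

Lemma cheb_addn j k :
  chebT (j + k) = chebT j * chebT k - (1 - 'X ^+ 2) * (chebV j * chebV k) /\
  chebV (j + k) = chebV j * chebT k + chebT j * chebV k.
Proof.
elim: j => [|j [IHT IHV]]; first by rewrite add0n chebT0 chebV0; split; ring.
by rewrite addSn !chebTS !chebVS IHT IHV; split; ring.
Qed.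

(** cos a cos b and sin a sin b as half sum and half difference of
    cos (a - b) and cos (a + b). *)
Lemma chebTM l k : chebT (k + l) * chebT k *+ 2 = chebT (k + l + k) + chebT l.
Proof.
rewrite (cheb_addn (k + l) k).1 (cheb_addn k l).1 (cheb_addn k l).2.
apply/eqP; rewrite -subr_eq0; apply/eqP.
transitivity (chebT l * (chebT k ^+ 2 + (1 - 'X ^+ 2) * chebV k ^+ 2 - 1)).
  ring.
by rewrite cheb_pell subrr mulr0.
Qed.

Lemma chebVM l k :
  (1 - 'X ^+ 2) * (chebV (k + l) * chebV k) *+ 2 = chebT l - chebT (k + l + k).
Proof.
rewrite (cheb_addn (k + l) k).1 (cheb_addn k l).1 (cheb_addn k l).2.
apply/eqP; rewrite -subr_eq0; apply/eqP.
transitivity (chebT l * (chebT k ^+ 2 + (1 - 'X ^+ 2) * chebV k ^+ 2 - 1)).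
  ring.
by rewrite cheb_pell subrr mulr0.
Qed.

(** Derivatives of cos (k t) and sin (k t) / sin t with respect to cos t. *)
Lemma deriv_cheb k :
  (chebT k)^`() = chebV k *+ k /\
  (1 - 'X ^+ 2) * (chebV k)^`() = 'X * chebV k - chebT k *+ k.
Proof.
elim: k => [|k [IHT IHV]].
  by rewrite chebT0 chebV0 derivC deriv0; split; rewrite ?mulr0n//; ring.
rewrite chebTS chebVS !(derivB, derivD, derivM, derivX, derivC, derivXn) IHT /=.
rewrite sub0r mul1r expr1.
split.
  by rewrite IHV; ring.
set D := (chebV k)^`() in IHV *.
transitivity ((1 - 'X ^+ 2) * (chebV k + chebV k *+ k) + 'X * ((1 - 'X ^+ 2) * D)).
  by ring.
by rewrite IHV; ring.
Qed.

Lemma size_cheb k : (size (chebT k) <= k.+1)%N /\ (size (chebV k) <= k)%N.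
Proof.
elim: k => [|k [IHT IHV]].
  by rewrite chebT0 chebV0 size_polyC size_poly0 oner_neq0.
rewrite chebTS chebVS; split; apply: (leq_trans (size_polyD _ _)).
  rewrite size_polyN geq_max; apply/andP; split.
    by rewrite mulrC (leq_trans (size_polyMleq _ _))// size_polyX; lia.
  apply: (leq_trans (size_polyMleq _ _)).
  have h : (size (1 - 'X ^+ 2 : {poly R})%R <= 3)%N.
    rewrite (leq_trans (size_polyD _ _))// size_polyN size_polyXn geq_max.
    by rewrite size_polyC oner_neq0.
  by have := leq_add h IHV; case: (_ + _)%N.
rewrite geq_max IHT andbT (leq_trans (size_polyMleq _ _))// size_polyX; lia.
Qed.

Lemma mulX_chebTS k : 'X * chebT k.+1 *+ 2 = chebT k.+2 + chebT k.
Proof. by rewrite [chebT k.+2]chebTS chebTS chebVS; ring. Qed.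

Lemma mulX_chebVS k : 'X * chebV k.+1 *+ 2 = chebV k.+2 + chebV k.
Proof. by rewrite [chebV k.+2]chebVS chebTS chebVS; ring. Qed.

End chebyshev.

Section orthonormal_chebyshev.
Variable R : rcfType.

(** The orthonormal polynomials for the arcsine law (e = false) and for
    1 - X^2 times the arcsine law (e = true). *)
Definition ocheb (e : bool) k : {poly R} :=
  if e then Num.sqrt 2 *: chebV R k.+1
  else if k is 0 then 1 else Num.sqrt 2 *: chebT R k.

Lemma ocheb_true k : ocheb true k = Num.sqrt 2 *: chebV R k.+1.
Proof. by []. Qed.
Lemma ocheb_false0 : ocheb false 0 = 1. Proof. by []. Qed.
Lemma ocheb_falseS k : ocheb false k.+1 = Num.sqrt 2 *: chebT R k.+1.
Proof. by []. Qed.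
Lemma ocheb_false k :
  ocheb false k = (if k == 0 then 1 else Num.sqrt 2) *: chebT R k.
Proof. by case: k => [|k]//; rewrite ocheb_false0 chebT0 scale1r. Qed.

Lemma sqrt2_sqr : Num.sqrt 2 * Num.sqrt 2 = 2 :> R.
Proof. by rewrite -expr2 sqr_sqrtr// ler0n. Qed.

Lemma ocheb_pell x k :
  (ocheb false k.+1).[x] ^+ 2 + (1 - x ^+ 2) * (ocheb true k).[x] ^+ 2 = 2.
Proof.
rewrite ocheb_falseS ocheb_true !hornerZ.
have /(congr1 (horner^~ x)) := cheb_pell R k.+1.
rewrite !(hornerD, hornerM, hornerXn, hornerN, hornerC, horner_exp, hornerX).
set t := _.[x]; set v := (chebV R k.+1).[x] => h.
transitivity (2 * (t ^+ 2 + (1 - x ^+ 2) * v ^+ 2)); last by rewrite h mulr1.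
by rewrite !exprMn sqr_sqrtr ?ler0n//; ring.
Qed.

Lemma size_ocheb e k : (size (ocheb e k) <= k.+1)%N.
Proof.
case: e.
  by rewrite ocheb_true (leq_trans (size_scale_leq _ _))// (size_cheb _ _).2.
case: k => [|k]; first by rewrite ocheb_false0 size_polyC oner_neq0.
by rewrite ocheb_falseS (leq_trans (size_scale_leq _ _))// (size_cheb _ _).1.
Qed.

(** The three-term recurrence, which lets the span of the ocheb grow by one
    degree at a time. For k = 0 the last index is truncated to 0; what counts is
    that it is at most k. *)
Lemma mulX_ocheb e k : exists a b : R,
  'X * ocheb e k = a *: ocheb e k.+1 + b *: ocheb e k.-1.
Proof.
have s2 : Num.sqrt 2 != 0 :> R by rewrite sqrtr_eq0 -ltNge ltr0n.
have half (p : {poly R}) : 2^-1 *: (p *+ 2) = p.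
  by rewrite -scaler_nat scalerA mulVf ?pnatr_eq0// scale1r.
case: e; case: k => [|k]; rewrite ?ocheb_true ?ocheb_falseS.
- exists 2^-1, 0; rewrite scale0r addr0 -scalerAr scalerA [2^-1 * _]mulrC -scalerA.
  congr (_ *: _); rewrite -[LHS]half; congr (_ *: _).
  by rewrite mulX_chebVS chebV0 addr0.
- exists 2^-1, 2^-1; rewrite -scalerDr -scalerDr -scalerAr.
  by rewrite scalerA [2^-1 * _]mulrC -scalerA -mulX_chebVS half.
- exists (Num.sqrt 2)^-1, 0.
  rewrite scale0r addr0 scalerA mulVf// scale1r chebTS chebT0 chebV0.
  by rewrite mulr0 subr0.
- exists 2^-1, (if k == 0 then (Num.sqrt 2)^-1 else 2^-1).
  rewrite -[k.+1.-1]/k [X in _ + _ *: X]ocheb_false [X in _ + X]scalerA.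
  have -> : (if k == 0 then (Num.sqrt 2)^-1 else 2^-1) *
      (if k == 0 then 1 else Num.sqrt 2) = 2^-1 * Num.sqrt 2 :> R.
    by case: eqP => // _; rewrite mulr1 -{2}sqrt2_sqr invfM mulfVK.
  rewrite scalerA -scalerDr -mulX_chebTS.
  by rewrite [2^-1 * _]mulrC -scalerA half scalerAr.
Qed.

(** The second hypothesis is the weak form of the differential equation
    ((1 - X^2) w)' = - X w of the weight w of the arcsine law: applied to p = V_k
    it gives l (T_k) = 0 for k > 0, and products of ocheb are combinations of
    the T_k. *)
Lemma ocheb_orthonormal (l : {scalar {poly R}}) :
    l 1 = 1 -> (forall p, l ((1 - 'X ^+ 2) * p^`() - 'X * p) = 0) ->
  forall e j k,
    l ((1 - 'X ^+ 2) ^+ (e : bool) * (ocheb e j * ocheb e k)) = (j == k)%:R.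
Proof.
move=> l1 lD.
have lT k : l (chebT R k) = (k == 0)%:R.
  case: k => [|k]; first by rewrite chebT0 l1.
  have := lD (chebV R k.+1); rewrite (deriv_cheb _ _).2 addrAC subrr add0r.
  rewrite raddfN raddfMn => /eqP; rewrite oppr_eq0 mulrn_eq0 /= => /eqP.
  by [].
have half (p q : {poly R}) : p *+ 2 = q -> l p = 2^-1 * l q.
  by move=> <-; rewrite raddfMn; field.
have scaleM (a b : R) (p q : {poly R}) : (a *: p) * (b *: q) = (a * b) *: (p * q).
  by rewrite -scalerAl -scalerAr scalerA.
move=> e j k; wlog jk : j k / (k <= j)%N => [hw|].
  have [/hw//|/ltnW /hw] := leqP k j.
  by rewrite [ocheb e k * _]mulrC eq_sym.
have [i ->] : exists i, j = (k + i)%N by exists (j - k)%N; rewrite subnKC.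
have kiE : (k + i == k)%N = (i == 0)%N by rewrite -{2}[k]addn0 eqn_add2l.
rewrite kiE; case: e; rewrite ?expr0 ?mul1r ?expr1.
- rewrite !ocheb_true scaleM sqrt2_sqr -scalerAr linearZ /=.
  rewrite -addSn (half _ _ (chebVM _ _ _)) mulrA mulfV ?pnatr_eq0// mul1r.
  by rewrite raddfB /= !lT subr0.
- rewrite !ocheb_false scaleM linearZ /=.
  rewrite (half _ _ (chebTM _ _ _)) raddfD /= !lT !addn_eq0.
  have [_|_] := eqVneq k 0%N; have [_|_] := eqVneq i 0%N => /=.
  + by field.
  + by rewrite !addr0 !mulr0.
  + by rewrite add0r mulr1 sqrt2_sqr divff// pnatr_eq0.
  + by rewrite addr0 !mulr0.
Qed.

End orthonormal_chebyshev.

(** * The arcsine law on [-1, 1] *)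

Import numFieldNormedType.Exports.
Local Open Scope classical_set_scope.
Local Open Scope ring_scope.

Section arcsine_density.
Variable R : realType.
Notation mu := (@lebesgue_measure R).
Implicit Types (f F : R -> R) (a b t : R) (p q : {poly R}).

(** The integrand may blow up at a and b, as the arcsine density does: F minus
    the indefinite integral of f is continuous on [a, b] with derivative 0
    inside, hence constant. *)
Lemma integrable_FTC2 f F a b : a < b ->
    mu.-integrable `[a, b] (EFin \o f) -> {in `]a, b[, continuous f} ->
    {within `[a, b], continuous F} ->
    {in `]a, b[, forall x : R, is_derive x 1 F (f x)} ->
  \int[mu]_(x in `[a, b]) f x = F b - F a.
Proof.
move=> ab fi fc Fc dF; pose G := parameterized_integral mu a ^~ f.
have Gc : {within `[a, b], continuous G}.
  exact: parameterized_integral_continuous (ltW ab) fi.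
have dFG x : x \in `]a, b[ -> is_derive x 1 (F \- G) (cst 0 x).
  move=> xab; rewrite -(subrr (f x)); apply: is_deriveB; first exact: dF.
  move: (xab); rewrite in_itv/= => /andP[ax xb].
  have [dG GE] := continuous_FTC1_closed xb fi ax (fc _ xab).
  apply: DeriveDef; first exact: dG.
  by rewrite -derive1E; exact: GE.
have [|c _] := MVT ab dFG.
  by move=> x; apply: continuousB; [exact: Fc|exact: Gc].
rewrite /= mul0r => /eqP; rewrite opprB addrACA -opprD addrC.
rewrite /G /parameterized_integral set_itv1 Rintegral_set1 addr0.
by move/eqP; lra.
Qed.

Definition arcsine_density t : R := (Num.sqrt (1 - t ^+ 2))^-1.

Lemma arcsine_density_ge0 t : 0 <= arcsine_density t.
Proof. by rewrite invr_ge0 sqrtr_ge0. Qed.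

Lemma one_sub_sqr_gt0 t : -1 < t < 1 -> 0 < 1 - t ^+ 2.
Proof. by move=> /andP[? ?]; nra. Qed.

Lemma one_sub_sqr_horner : (fun t => 1 - t ^+ 2) = horner (1 - 'X ^+ 2).
Proof. by apply/funext => t; rewrite hornerD hornerN hornerXn hornerC. Qed.

Lemma continuous_sqrt_one_sub_sqr : continuous (fun t => Num.sqrt (1 - t ^+ 2)).
Proof.
move=> t; apply: (@continuous_comp _ _ _ (fun t => 1 - t ^+ 2)).
  by rewrite one_sub_sqr_horner; exact: continuous_horner.
exact: sqrt_continuous.
Qed.

Lemma continuous_arcsine_density : {in `]-1, 1[, continuous arcsine_density}.
Proof.
move=> t; rewrite in_itv/= => /one_sub_sqr_gt0 t1.
apply: (@continuousV _ _ (fun t => Num.sqrt (1 - t ^+ 2)) t).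
  by rewrite gt_eqF// sqrtr_gt0.
exact: continuous_sqrt_one_sub_sqr.
Qed.

Let I (e : R) : set R := `[-1 + e, 1 - e].

Let I_sub e : 0 < e -> I e `<=` `]-1, 1[.
Proof.
by move=> e0 t; rewrite /I /= !in_itv/= => /andP[? ?]; apply/andP; split; lra.
Qed.

Let I_le e e' : e' <= e -> I e `<=` I e'.
Proof.
by move=> e0 t; rewrite /I /= !in_itv/= => /andP[? ?]; apply/andP; split; lra.
Qed.

Let I_bigcup : \bigcup_n I (n.+2%:R^-1) = `]-1, 1[%classic.
Proof.
apply/seteqP; split=> [t [n _]|t].
  by apply: I_sub; rewrite invr_gt0 ltr0n.
rewrite /= in_itv/= => /andP[t1 t2].
have e0 : 0 < Num.min (1 + t) (1 - t) by rewrite lt_min; apply/andP; split; lra.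
have /cvgrPdist_lt /(_ _ e0) [N _ Nh] := @cvg_harmonic R.
exists N => //; have := Nh N.+1 (leqnSn _).
rewrite /= sub0r normrN gtr0_norm ?invr_gt0 ?ltr0n// lt_min.
move: (_^-1) => e /andP[? ?].
by rewrite /I /= in_itv/=; apply/andP; split; lra.
Qed.

(** Over [-1 + e, 1 - e] the integral is a difference of two arcsines, at most
    pi; monotone convergence then covers ]-1, 1[. *)
Lemma integrable_arcsine_density :
  mu.-integrable `[-1, 1] (EFin \o arcsine_density).
Proof.
have m1 : measurable_fun (`]-1, 1[%classic : set R) arcsine_density.
  apply: open_continuous_measurable_fun => // t.
  by rewrite inE; exact: continuous_arcsine_density.
apply/integrableP; split.
  apply/measurable_EFinP; apply/measurable_fun_itv_bndo_bndcP.
  exact/measurable_fun_itv_obnd_cbndP.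
under eq_integral do rewrite /= ger0_norm ?arcsine_density_ge0//.
rewrite integral_itv_bndoo; last exact/measurable_EFinP.
rewrite -I_bigcup.
have cvgI : (\int[mu]_(t in I n.+2%:R^-1) (arcsine_density t)%:E @[n --> \oo] -->
    \int[mu]_(t in \bigcup_n I n.+2%:R^-1) (arcsine_density t)%:E)%E.
  apply: ge0_nondecreasing_set_cvg_integral => //.
  - apply/nondecreasing_seqP => n; apply/subsetPset/I_le.
    by rewrite lef_pV2 ?posrE ?ltr0n// ler_nat.
  - by move=> n; exact: measurable_itv.
  - move=> n; apply/measurable_EFinP; apply: measurable_funS m1 => //.
    by apply: I_sub; rewrite invr_gt0 ltr0n.
  - by move=> n t _; rewrite lee_fin arcsine_density_ge0.
apply: (@le_lt_trans _ _ (pi : R)%:E); last exact: ltry.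
rewrite -(cvg_lim _ cvgI)//; apply: lime_le.
  by apply/cvg_ex; eexists; exact: cvgI.
apply: nearW => n.
have: 0 < n.+2%:R^-1 :> R by rewrite invr_gt0 ltr0n.
have: n.+2%:R^-1 < 1 :> R by rewrite invf_lt1 ?ltr0n// ltr1n.
move: (n.+2%:R^-1) => e e1 e0.
have asin_cont t : t \in I e -> {for t, continuous (@asin R)}.
  rewrite inE => /(I_sub e0); rewrite /= in_itv/=; exact: continuous_asin.
have ab : -1 + e < 1 - e :> R by lra.
rewrite (@continuous_FTC2 _ _ (@asin R))//.
- have := @asin_lepi2 R (1 - e).
  have := @asin_geNpi2 R (-1 + e).
  by rewrite -EFinB lee_fin => ? ?; lra.
- apply: continuous_in_subspaceT => t /set_mem/(I_sub e0).
  exact: continuous_arcsine_density.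
- split.
  + move=> t tI; apply: ex_derive; apply: is_derive1_asin.
    have : `](-1 + e), (1 - e)[%classic t by [].
    by move=> /subset_itv_oo_cc /(I_sub e0); rewrite /= in_itv.
  + apply: cvg_at_right_filter; apply: asin_cont; rewrite inE /I /= in_itv/=.
    by rewrite lexx ltW.
  + apply: cvg_at_left_filter; apply: asin_cont; rewrite inE /I /= in_itv/=.
    by rewrite lexx ltW.
- move=> t tI; rewrite derive1E; apply: derive_val.
  apply: is_derive1_asin.
  have : `](-1 + e), (1 - e)[%classic t by [].
  by move=> /subset_itv_oo_cc /(I_sub e0); rewrite /= in_itv.
Qed.

End arcsine_density.

Section arcsine_functional.
Variable R : realType.
Notation mu := (@lebesgue_measure R).
Notation w := (@arcsine_density R).
Implicit Types (t : R) (p q : {poly R}).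

Lemma integrable_poly_arcsine p :
  mu.-integrable `[-1, 1] (EFin \o (fun t => p.[t] * w t)).
Proof.
have [M [_ Mp]] : bounded_set (horner p @` `[-1, 1]).
  apply: compact_bounded; apply: continuous_compact; last exact: segment_compact.
  by apply: continuous_subspaceT => t; exact: continuous_horner.
apply: (@integrableMr _ _ _ mu _ _ (horner p) (EFin \o w)) => //.
- apply: measurable_funTS; apply: continuous_measurable_fun.
  exact: continuous_horner.
- exists M; split => [|y My t t1]; first exact: num_real.
  by apply: Mp => //; exists t.
- exact: integrable_arcsine_density.
Qed.

Definition arcsine_int p : R := \int[mu]_(t in `[-1, 1]) (p.[t] * w t).

Lemma arcsine_int_is_linear : scalar arcsine_int.
Proof.
move=> a p q; rewrite /arcsine_int -RintegralZl//; last first.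
  exact: integrable_poly_arcsine.
rewrite -RintegralD//; last 2 first.
- have := integrable_poly_arcsine (a *: p); apply: eq_integrable => // t _ /=.
  by rewrite hornerZ mulrA.
- exact: integrable_poly_arcsine.
by apply: eq_Rintegral => t _; rewrite hornerD hornerZ; ring.
Qed.

HB.instance Definition _ := GRing.isLinear.Build R {poly R} R _ arcsine_int
  arcsine_int_is_linear.

Lemma arcsine_int1_gt0 : 0 < arcsine_int 1.
Proof.
have i1 := integrable_poly_arcsine 1.
rewrite /arcsine_int /Rintegral -lte_fin fineK; last exact: integrable_fin_num i1.
have m1 : measurable_fun (`]-1, 1[%classic : set R)
    (fun t : R => (1.[t] * w t)%:E).
  apply: measurable_funS (measurable_int mu i1) => //.
  exact: subset_itv_oo_cc.
rewrite integral_itv_bndoo//.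
(* the density is at least 1 inside, but vanishes at the end points since
   0^-1 = 0 *)
apply: (@lt_le_trans _ _ (\int[mu]_(t in `](-1)%R, 1%R[) cst 1 t)%E).
  rewrite integral_cst// mul1e /= lebesgue_measure_itv/=.
  by rewrite ifT ?lte_fin; lra.
apply: ge0_le_integral => //.
move=> t; rewrite /= in_itv/= => t1; rewrite lee_fin hornerC mul1r.
have t0 := one_sub_sqr_gt0 t1.
rewrite /arcsine_density invf_ge1 ?sqrtr_gt0//.
by rewrite -[leRHS]sqrtr1 ler_sqrt// lerBlDr lerDl sqr_ge0.
Qed.

(** The integrand is the derivative of p (1 - t^2) w = p sqrt (1 - t^2), which
    vanishes at both ends of the interval. *)
Lemma arcsine_int_deriv p : arcsine_int ((1 - 'X ^+ 2) * p^`() - 'X * p) = 0.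
Proof.
rewrite /arcsine_int.
rewrite (@integrable_FTC2 _ _ (fun t => p.[t] * Num.sqrt (1 - t ^+ 2)))//.
- by rewrite expr1n sqrrN expr1n subrr sqrtr0 !mulr0 subrr.
- exact: integrable_poly_arcsine.
- move=> t t1; apply: continuousM; first exact: continuous_horner.
  exact: continuous_arcsine_density.
- apply: continuous_subspaceT => t; apply: continuousM.
    exact: continuous_horner.
  exact: continuous_sqrt_one_sub_sqr.
- move=> t; rewrite in_itv/= => /one_sub_sqr_gt0 t0.
  have -> : (fun t => p.[t] * Num.sqrt (1 - t ^+ 2)) =
      horner p * (Num.sqrt \o horner (1 - 'X ^+ 2)).
    by apply/funext => u; rewrite !fctE hornerD hornerN hornerXn hornerC.
  have t0' : 0 < (1 - 'X ^+ 2).[t] by rewrite hornerD hornerN hornerXn hornerC.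
  have ds := is_derive1_sqrt t0'.
  apply: is_derive_eq.
  rewrite /GRing.scale /=.
  rewrite derivB derivXn derivC sub0r expr1 /arcsine_density.
  rewrite !(hornerD, hornerN, hornerM, hornerMn, hornerX, hornerXn, hornerC).
  have s0 : Num.sqrt (1 - t ^+ 2) != 0 by rewrite gt_eqF// sqrtr_gt0.
  rewrite -[X in _ = (X * _ - _) * _](sqr_sqrtr (ltW t0)).
  by field.
Qed.

Definition arcsine_mean p : R := (arcsine_int 1)^-1 * arcsine_int p.

Lemma arcsine_mean_is_linear : scalar arcsine_mean.
Proof. by move=> a p q; rewrite /arcsine_mean linearP /=; ring. Qed.

HB.instance Definition _ := GRing.isLinear.Build R {poly R} R _ arcsine_mean
  arcsine_mean_is_linear.

Lemma arcsine_mean_orthonormal e j k :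
  arcsine_mean ((1 - 'X ^+ 2) ^+ (e : bool) * (ocheb R e j * ocheb R e k)) =
  (j == k)%:R.
Proof.
apply: (ocheb_orthonormal (l := arcsine_mean)).
  by rewrite /= /arcsine_mean mulVf// gt_eqF// arcsine_int1_gt0.
by move=> p; rewrite /= /arcsine_mean arcsine_int_deriv mulr0.
Qed.

End arcsine_functional.

(** * Integration against a density and over products *)

Section integral_density.
Local Open Scope ereal_scope.
Context {disp : measure_display} {T : measurableType disp} {R : realType}.
Variables (mu nu : {measure set T -> \bar R}) (f : T -> R).
Hypothesis f_ge0 : forall x, (0 <= f x)%R.
Hypothesis mf : measurable_fun setT f.
(* nu is a separate measure rather than an integral over subsets, so that the
   results apply to whatever measure structure it was built with *)
Hypothesis nuE : forall A, measurable A -> nu A = \int[mu]_(x in A) (f x)%:E.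

Import HBNNSimple.

Let integral_density_nnsfun (h : {nnsfun T >-> R}) :
  \int[nu]_x (h x)%:E = \int[mu]_x ((h x)%:E * (f x)%:E).
Proof.
have mh r : measurable_fun setT (fun x => (r * \1_(h @^-1` [set r]) x)%:E).
  by apply: (measurable_comp measurableT) => //; exact: measurable_funM.
have mfE : measurable_fun setT (EFin \o f) by exact/measurable_EFinP.
under eq_integral do rewrite fimfunE -fsumEFin//.
rewrite ge0_integral_fsum//; last by move=> m y _; exact: nnfun_muleindic_ge0.
under [RHS]eq_integral => x _.
  rewrite fimfunE -fsumEFin// ge0_mule_fsuml; last first.
    by move=> y; exact: nnfun_muleindic_ge0.
  over.
rewrite ge0_integral_fsum//; last 2 first.
- by move=> y; exact: emeasurable_funM.
- move=> m y _; apply: mule_ge0; last by rewrite lee_fin.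
  exact: nnfun_muleindic_ge0.
apply: eq_fsbigr => r rh.
under [LHS]eq_integral do rewrite EFinM.
rewrite integralZl_indic_nnsfun//.
under [RHS]eq_integral do rewrite EFinM -muleA.
rewrite ge0_integralZl//.
- under [in RHS]eq_integral do rewrite muleC.
  rewrite [in RHS](eq_integral ((EFin \o f) \_ (h @^-1` [set r]))); last first.
    by move=> x _; rewrite epatch_indic.
  by rewrite -integral_mkcond integral_indic// setIT nuE.
- by apply: emeasurable_funM => //; exact/measurable_EFinP.
- by move=> t _; rewrite mule_ge0 ?lee_fin ?f_ge0.
- by move: rh; rewrite inE => -[t _ <-]; rewrite lee_fin.
Qed.

Lemma ge0_integral_density (h : T -> \bar R) : measurable_fun setT h ->
  (forall x, 0 <= h x) -> \int[nu]_x h x = \int[mu]_x (h x * (f x)%:E).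
Proof.
move=> mh h0; pose g := nnsfun_approx measurableT mh.
have mfE : measurable_fun setT (EFin \o f) by exact/measurable_EFinP.
have -> : \int[nu]_x h x = limn (fun n => \int[nu]_x (g n x)%:E).
  rewrite -monotone_convergence//=.
  - apply: eq_integral => x _; apply/esym/cvg_lim => //.
    by apply: cvg_nnsfun_approx => // *; exact: h0.
  - by move=> n; exact/measurable_EFinP/measurable_funP.
  - by move=> n x _; rewrite lee_fin.
  - by move=> x _ a b ab; rewrite lee_fin; exact/lefP/nd_nnsfun_approx.
have -> : \int[mu]_x (h x * (f x)%:E) =
    limn (fun n => \int[mu]_x ((g n x)%:E * (f x)%:E)).
  rewrite -monotone_convergence//=.
  - apply: eq_integral => x _; apply/esym/cvg_lim => //.
    apply: cvgeZr => //; apply: cvg_nnsfun_approx => // *; exact: h0.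
  - move=> n; apply: emeasurable_funM => //.
    exact/measurable_EFinP/measurable_funP.
  - by move=> n x _; rewrite mule_ge0 ?lee_fin.
  - move=> x _ a b ab; rewrite lee_wpmul2r ?lee_fin//.
    exact/lefP/nd_nnsfun_approx.
by congr (limn _); apply/funext => n; exact: integral_density_nnsfun.
Qed.

Lemma integrable_density (h : T -> R) : measurable_fun setT h ->
  mu.-integrable setT (EFin \o (h \* f)%R) -> nu.-integrable setT (EFin \o h).
Proof.
move=> mh /integrableP[_ ioo]; apply/integrableP; split.
  exact/measurable_EFinP.
rewrite ge0_integral_density//; last first.
  by do 2 apply: measurableT_comp => //.
rewrite (eq_integral (fun x => `|(EFin \o (h \* f)%R) x|))// => x _ /=.
by rewrite normrM EFinM (ger0_norm (f_ge0 x)).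
Qed.

Lemma Rintegral_density (h : T -> R) : measurable_fun setT h ->
  (\int[nu]_x h x = \int[mu]_x (h x * f x))%R.
Proof.
move=> mh; congr fine; rewrite integralE [RHS]integralE.
have mhE : measurable_fun setT (EFin \o h) by exact/measurable_EFinP.
rewrite !ge0_integral_density//; last 2 first.
- exact: measurable_funeneg.
- exact: measurable_funepos.
congr (_ - _); apply: eq_integral => x _.
- by rewrite !funeposE/= -!EFin_max -EFinM maxr_pMl// mul0r.
- by rewrite !funenegE/= -!EFin_max -EFinM maxr_pMl// mul0r mulNr.
Qed.

End integral_density.

Section integral_product.
Context {d1 d2 : measure_display} {T1 : measurableType d1}
  {T2 : measurableType d2} {R : realType}.
Variables (m1 : {sigma_finite_measure set T1 -> \bar R}).
Variables (m2 : {sigma_finite_measure set T2 -> \bar R}).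
Variables (f : T1 -> R) (g : T2 -> R).
Hypothesis fi : m1.-integrable setT (EFin \o f).
Hypothesis gi : m2.-integrable setT (EFin \o g).

Lemma integrable_tensor :
  (m1 \x m2)%E.-integrable setT (EFin \o (fun z => f z.1 * g z.2)).
Proof.
have mf : measurable_fun setT f by exact/measurable_EFinP/(measurable_int m1 fi).
have mg : measurable_fun setT g by exact/measurable_EFinP/(measurable_int m2 gi).
apply/integrable12ltyP.
  apply/measurable_EFinP; apply: measurable_funM.
    exact: (measurableT_comp mf measurable_fst).
  exact: (measurableT_comp mg measurable_snd).
have -> : (\int[m1]_x \int[m2]_y `|(f x * g y)%:E| =
    \int[m1]_x (`|(f x)%:E| * \int[m2]_y `|(g y)%:E|))%E.
  apply: eq_integral => x _ /=; rewrite -ge0_integralZl//.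
  - by apply: eq_integral => y _; rewrite normrM EFinM.
  - by apply/measurable_EFinP; exact: measurableT_comp.
case/integrableP: gi => _ gfin; case/integrableP: fi => _ ffin.
rewrite ge0_integralZr//.
- rewrite lte_mul_pinfty//; first exact: integral_ge0.
  by rewrite ge0_fin_numE//; exact: integral_ge0.
- by apply/measurable_EFinP; exact: measurableT_comp.
- exact: integral_ge0.
Qed.

Lemma Rintegral_tensor :
  \int[(m1 \x m2)%E]_z (f z.1 * g z.2) = \int[m1]_x f x * \int[m2]_y g y.
Proof.
rewrite -RintegralZr//; congr fine.
rewrite -(integral12_prod_meas1 integrable_tensor).
apply: eq_integral => x _; rewrite /fubini_F /=.
under eq_integral do rewrite EFinM.
by rewrite integralZl// EFinM fineK//; exact: integrable_fin_num gi.
Qed.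

End integral_product.

Section integral_lebesgue_tuple.
Variable R : realType.
Notation mu := (@lebesgue_measure R).

(** Fubini's theorem for a product of functions of one coordinate each, by
    splitting off the first coordinate. *)
Lemma lebesgue_tuple_prod d (f : 'I_d -> R -> R) :
    (forall i, mu.-integrable setT (EFin \o f i)) ->
  (lebesgue_tuple R d).-integrable setT
    (EFin \o (fun x : Rd R d => \prod_(i < d) f i (tnth x i))) /\
  \int[lebesgue_tuple R d]_x (\prod_(i < d) f i (tnth x i)) =
    \prod_(i < d) \int[mu]_t f i t.
Proof.
elim: d f => [|d IH] f fi.
  have prodE : (fun x : Rd R 0 => \prod_(i < 0) f i (tnth x i)) = cst 1.
    by apply/funext => x; rewrite big_ord0.
  have mass1 : lebesgue_tuple R 0 setT = 1%E by rewrite /= diracT.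
  have int1 : (\int[lebesgue_tuple R 0]_x (cst 1%:E) x = 1)%E.
    by rewrite integral_cst// mul1e; exact: mass1.
  split; last first.
    rewrite big_ord0 /Rintegral; under eq_integral do rewrite big_ord0.
    by rewrite int1.
  apply/integrableP; split.
    by rewrite prodE; exact/measurable_EFinP.
  under eq_integral do rewrite /= big_ord0 normr1.
  by rewrite int1 ltry.
have [Ki KE] := IH (fun i => f (lift ord0 i)) (fun i => fi _).
set K := fun x : Rd R d => \prod_(i < d) f (lift ord0 i) (tnth x i).
have ci := integrable_tensor (fi ord0) Ki.
have consE z : \prod_(i < d.+1) f i (tnth (tuple_cons z) i) = f ord0 z.1 * K z.2.
  rewrite big_ord_recl /tuple_cons tnth0; congr (_ * _).
  by apply: eq_bigr => i _; rewrite tnthS.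
have mf : measurable_fun setT
    (EFin \o (fun x : Rd R d.+1 => \prod_(i < d.+1) f i (tnth x i))).
  apply/measurable_EFinP; apply: measurable_prod => i _.
  have /measurable_EFinP mfi := measurable_int mu (fi i).
  exact: (measurableT_comp mfi (measurable_tnth _)).
have ci' : (mu \x lebesgue_tuple R d)%E.-integrable (@tuple_cons R d @^-1` setT)
    ((EFin \o (fun x : Rd R d.+1 => \prod_(i < d.+1) f i (tnth x i)))
     \o @tuple_cons R d).
  by apply: eq_integrable ci => // z _; rewrite /= consE.
have pushE (h : Rd R d.+1 -> \bar R) :
    (\int[lebesgue_tuple R d.+1]_x h x =
     \int[pushforward (mu \x lebesgue_tuple R d) (@tuple_cons R d)]_x h x)%E.
  by [].
split.
  have /integrableP[_ foo] :=
    integrable_pushforward (@measurable_tuple_cons R d) mf ci' measurableT.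
  by apply/integrableP; split => //; rewrite pushE.
rewrite big_ord_recl -KE -Rintegral_tensor//; congr fine.
rewrite pushE (integral_pushforward (@measurable_tuple_cons R d) mf ci')//.
by apply: eq_integral => z _; rewrite /= consE.
Qed.

End integral_lebesgue_tuple.

(** * Integrals of products of univariate polynomials over the cube *)

Lemma mnormalize_fin {disp} {T : measurableType disp} {R : realType}
    (mu : {measure set T -> \bar R}) (P : probability T R) (r : R) A :
  mu setT = r%:E -> 0 < r -> mnormalize mu P A = (mu A * (r^-1)%:E)%E.
Proof. by move=> mur r0; rewrite /mnormalize mur eqe gt_eqF. Qed.

Section weighted_equilibrium_integral.
Variables (R : realType) (d : nat).
Notation mu := (@lebesgue_measure R).
Notation c := (@arcsine_int R 1).
Implicit Types (eps : {ffun 'I_d -> bool}) (q : {poly R}).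

(* the cut-off makes the domain of integration the whole line, so that the
   integral over the cube factors *)
Let u q : R -> R := (fun t => q.[t] * arcsine_density t) \_ `[-1, 1].

Let u_integrable q : mu.-integrable setT (EFin \o u q).
Proof.
rewrite /u -restrict_EFin; apply/integrable_restrict => //.
by rewrite setTI; exact: integrable_poly_arcsine.
Qed.

Let u_integral q : \int[mu]_t u q t = arcsine_int q.
Proof. by rewrite /arcsine_int [RHS]Rintegral_mkcond. Qed.

Let patch_cube (g : 'I_d -> R -> R) (x : Rd R d) :
  ((fun y : Rd R d => \prod_(i < d) g i (tnth y i)) \_ (@cube R d)) x =
  \prod_(i < d) (g i \_ `[-1, 1]) (tnth x i).
Proof.
rewrite patchE; case: ifPn => [/set_mem cx|].
  by apply: eq_bigr => i _; rewrite patchE mem_set//= in_itv/=; exact: cx.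
move=> /negP; rewrite inE => /existsNP[i ci]; apply/esym/eqP/prodf_eq0.
exists i => //; rewrite patchE memNset//= in_itv/=; exact: ci.
Qed.

Let arcsineE (A : set (Rd R d)) : measurable A ->
  @arcsine_measure R d A =
  (\int[lebesgue_tuple R d]_(x in A) (\prod_(i < d) u 1 (tnth x i))%:E)%E.
Proof.
move=> mA; rewrite /arcsine_measure /with_density integral_mkcondr.
apply: eq_integral => x _; rewrite restrict_EFin /=; congr EFin.
rewrite /u /arcsine_weight (patch_cube (fun _ t => (Num.sqrt (1 - t ^+ 2))^-1)).
apply: eq_bigr => i _; rewrite !patchE; case: ifP => // _.
by rewrite hornerC mul1r.
Qed.

Let arcsine_mass : @arcsine_measure R d setT = (c ^+ d)%:E.
Proof.
rewrite arcsineE//.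
have [ui uE] := lebesgue_tuple_prod (fun _ : 'I_d => u_integrable 1).
rewrite -[LHS]fineK; last exact: integrable_fin_num ui.
congr EFin; rewrite [LHS]uE.
by under eq_bigr do rewrite u_integral; rewrite prodr_const card_ord.
Qed.

Let u1_ge0 t : 0 <= u 1 t.
Proof.
rewrite /u patchE; case: ifP => // _.
by rewrite hornerC mul1r arcsine_density_ge0.
Qed.

Let eq_density (x : Rd R d) : R := (c ^+ d)^-1 * \prod_(i < d) u 1 (tnth x i).

Let cd_gt0 : 0 < c ^+ d.
Proof. by rewrite exprn_gt0// arcsine_int1_gt0. Qed.

Let measurable_u q : measurable_fun setT (u q).
Proof. by have /measurable_EFinP := measurable_int mu (u_integrable q). Qed.

Let measurable_prod_u (q : 'I_d -> {poly R}) :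
  measurable_fun setT (fun x : Rd R d => \prod_(i < d) u (q i) (tnth x i)).
Proof.
apply: measurable_prod => i _.
exact: (measurableT_comp (measurable_u _) (measurable_tnth _)).
Qed.

Let equilibriumE (A : set (Rd R d)) : measurable A ->
  @equilibrium R d A = (\int[lebesgue_tuple R d]_(x in A) (eq_density x)%:E)%E.
Proof.
move=> mA; transitivity (arcsine_measure A * ((c ^+ d)^-1)%:E)%E.
  exact: mnormalize_fin arcsine_mass cd_gt0.
rewrite arcsineE// muleC -ge0_integralZl//.
- by apply/measurable_EFinP; apply: measurable_funTS; exact: measurable_prod_u.
- by move=> x _; rewrite lee_fin prodr_ge0.
- by rewrite lee_fin invr_ge0 ltW.
Qed.

Let cut_weight eps (x : Rd R d) : R := (cube_weight eps \_ (@cube R d)) x.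

Let measurable_cut_weight eps : measurable_fun setT (cut_weight eps).
Proof.
apply/(measurable_restrictT _ _).1; first exact: measurable_cube.
exact: measurable_cube_weight.
Qed.

Let cut_weight_ge0 eps x : 0 <= cut_weight eps x.
Proof.
rewrite /cut_weight patchE; case: ifPn => // /set_mem; exact: cube_weight_ge0.
Qed.

Let weightedE eps (A : set (Rd R d)) : measurable A ->
  weighted_equilibrium eps A =
  (\int[@equilibrium R d]_(x in A) (cut_weight eps x)%:E)%E.
Proof.
move=> mA; rewrite /weighted_equilibrium /with_density integral_mkcondr.
by apply: eq_integral => x _; rewrite restrict_EFin.
Qed.

(** The weight, the arcsine density and the indicator of the cube are all
    products over the coordinates, and so is the normalizing constant c ^+ d. *)
Lemma weighted_equilibrium_prod eps (q : 'I_d -> {poly R}) :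
  (weighted_equilibrium eps).-integrable setT
    (EFin \o (fun x : Rd R d => \prod_(i < d) (q i).[tnth x i])) /\
  \int[weighted_equilibrium eps]_x (\prod_(i < d) (q i).[tnth x i]) =
    \prod_(i < d) arcsine_mean ((1 - 'X ^+ 2) ^+ eps i * q i).
Proof.
set h := fun x : Rd R d => _.
have mh : measurable_fun setT h.
  apply: measurable_prod => i _.
  apply: (measurableT_comp _ (measurable_tnth _)).
  by apply: continuous_measurable_fun; exact: continuous_horner.
have eq_density_ge0 x : 0 <= eq_density x.
  by rewrite mulr_ge0 ?invr_ge0 ?(ltW cd_gt0)// prodr_ge0.
have mdens : measurable_fun setT eq_density.
  by apply: measurable_funM => //; exact: measurable_prod_u.
have mhw : measurable_fun setT (h \* cut_weight eps)%R by exact: measurable_funM.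
have hE x : (h x * cut_weight eps x) * eq_density x =
    (c ^+ d)^-1 * \prod_(i < d) u ((1 - 'X ^+ 2) ^+ eps i * q i) (tnth x i).
  rewrite mulrCA /cut_weight /cube_weight.
  rewrite (patch_cube (fun i t => (1 - t ^+ 2) ^+ eps i)) -mulrA -!big_split/=.
  congr (_ * _); apply: eq_bigr => i _; rewrite /u !patchE; case: ifP => _.
    rewrite hornerC mul1r hornerM horner_exp hornerD hornerN hornerXn hornerC.
    by ring.
  by rewrite !mulr0.
have [ui uE] := lebesgue_tuple_prod
  (fun i => u_integrable ((1 - 'X ^+ 2) ^+ eps i * q i)).
have hi : (lebesgue_tuple R d).-integrable setT
    (EFin \o ((h \* cut_weight eps) \* eq_density)).
  have := integrableZl measurableT (c ^+ d)^-1 ui.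
  by apply: eq_integrable => // x _; rewrite /= hE EFinM.
split.
  apply: (integrable_density (cut_weight_ge0 eps) _ (weightedE eps)) => //.
  exact: (integrable_density eq_density_ge0 _ equilibriumE).
rewrite (Rintegral_density (cut_weight_ge0 eps) _ (weightedE eps))//.
rewrite (Rintegral_density eq_density_ge0 _ equilibriumE)//.
under eq_Rintegral do rewrite hE.
rewrite RintegralZl// uE.
under eq_bigr do rewrite u_integral.
rewrite -exprVn -[d in _ ^+ d]card_ord -prodr_const -big_split.
by apply: eq_bigr.
Qed.

End weighted_equilibrium_integral.

(** * Kernels and Christoffel functions from an orthonormal family *)

Section peval.
Variables (R : realType) (d : nat).
Implicit Types (p q : {mpoly R[d]}) (x : Rd R d).

Lemma pevalM p q x : peval (p * q) x = peval p x * peval q x.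
Proof. by rewrite /peval mevalM. Qed.

Lemma pevalZ a p x : peval (a *: p) x = a * peval p x.
Proof. by rewrite /peval mevalZ. Qed.

Lemma peval_sum (I : finType) (P : pred I) (F : I -> {mpoly R[d]}) x :
  peval (\sum_(i | P i) F i) x = \sum_(i | P i) peval (F i) x.
Proof. by rewrite /peval raddf_sum. Qed.

End peval.

Section orthonormal_family.
Variables (R : realType) (d : nat) (nu : {measure set (Rd R d) -> \bar R}).
Implicit Types (p q : {mpoly R[d]}) (x y : Rd R d).
Notation dot := (L2dot nu).

Hypothesis nu_poly : forall p, nu.-integrable setT (EFin \o (fun x => peval p x)).

Lemma L2dotC p q : dot p q = dot q p.
Proof. by apply: eq_Rintegral => x _; rewrite mulrC. Qed.

Lemma L2dot_suml (I : finType) (P : pred I) (c : I -> R)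
    (F : I -> {mpoly R[d]}) q :
  dot (\sum_(i | P i) c i *: F i) q = \sum_(i | P i) c i * dot (F i) q.
Proof.
have polyM p r : nu.-integrable setT (EFin \o (fun x => peval p x * peval r x)).
  by apply: eq_integrable (nu_poly (p * r)) => // x _; rewrite /= pevalM.
transitivity (fine (\sum_(i | P i)
    \int[nu]_x (peval (c i *: F i) x * peval q x)%:E)%E).
  rewrite -integral_sum//; last by move=> i; exact: polyM.
  congr fine; apply: eq_integral => x _.
  by rewrite peval_sum mulr_suml sumEFin.
rewrite (eq_bigr (fun i => (c i * dot (F i) q)%:E)) ?sumEFin// => i _.
rewrite /L2dot -RintegralZl//.
rewrite /Rintegral fineK; last first.
  apply: integrable_fin_num => //; apply: eq_integrable (polyM (c i *: F i) q) => //.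
  by move=> x _; rewrite /= pevalZ mulrA.
by apply: eq_integral => x _; rewrite pevalZ mulrA.
Qed.

(** Two orthonormal bases P and P' are related by the matrix of their inner
    products, read by rows for P and by columns for P', so that both kernels are
    the same double sum. *)
Lemma kernel_basis_indep m (P P' : {ffun bmultinom d m.+1 -> {mpoly R[d]}}) x y :
    orthonormal_basis nu P -> orthonormal_basis nu P' ->
  \sum_(a : bmultinom d m.+1 | mdeg a == m) peval (P a) x * peval (P a) y =
  \sum_(a : bmultinom d m.+1 | mdeg a == m) peval (P' a) x * peval (P' a) y.
Proof.
have expand (S S' : {ffun bmultinom d m.+1 -> {mpoly R[d]}})
    (a : bmultinom d m.+1) :
    orthonormal_basis nu S -> orthonormal_basis nu S' -> mdeg a == m ->
    S a = \sum_(b : bmultinom d m.+1 | mdeg b == m) dot (S a) (S' b) *: S' b.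
  move=> [S1 _ _] [_ S'2 S'3] /eqP am; have [c Sa] := S'3 _ (S1 _ am).
  rewrite {1}Sa; apply: eq_bigr => b bm; congr (_ *: _).
  rewrite Sa L2dot_suml (bigD1 b)//= S'2 ?eqxx ?mulr1; try exact/eqP.
  by rewrite big1 ?addr0// => e /andP[em eb]; rewrite S'2 ?(negbTE eb) ?mulr0//;
    exact/eqP.
move=> oP oP'.
transitivity (\sum_(a : bmultinom d m.+1 | mdeg a == m)
    \sum_(b : bmultinom d m.+1 | mdeg b == m)
    dot (P a) (P' b) * peval (P' b) x * peval (P a) y).
  apply: eq_bigr => a am; rewrite -mulr_suml {1}(expand _ _ _ oP oP' am) peval_sum.
  by under eq_bigr do rewrite pevalZ.
rewrite exchange_big; apply: eq_bigr => b bm /=.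
rewrite [in RHS](expand _ _ _ oP' oP bm) [X in _ = _ * X]peval_sum mulr_sumr.
rewrite -(expand _ _ _ oP' oP bm).
by apply: eq_bigr => a _; rewrite pevalZ L2dotC; ring.
Qed.

(* The family Q is graded like the monomials: those Q a with mdeg a < n span
   the polynomials of degree less than n. *)
Variable Q : multinom d -> {mpoly R[d]}.
Hypothesis Q_ortho : forall a b, dot (Q a) (Q b) = (a == b)%:R.
Hypothesis Q_size : forall a, (msize (Q a) <= (mdeg a).+1)%N.
Hypothesis Q_span : forall n p, (msize p <= n)%N ->
  exists c : bmultinom d n -> R, p = \sum_(a : bmultinom d n) c a *: Q a.

Lemma L2dot_orthonormal_coef n (c : bmultinom d n -> R) b :
  dot (\sum_(a : bmultinom d n) c a *: Q a) (Q b) =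
  if insub b is Some b' then c b' else 0.
Proof.
rewrite L2dot_suml; case: insubP => [b' _ b'E|nb].
  rewrite (bigD1 b')//= Q_ortho -b'E eqxx mulr1 big1 ?addr0// => a ab.
  by rewrite Q_ortho (inj_eq val_inj) (negbTE ab) mulr0.
rewrite big1// => a _; rewrite Q_ortho; case: eqP => [ab|]; last by rewrite mulr0.
by rewrite -ab bmdeg in nb.
Qed.

Lemma family_orthogonal_lower p b : (msize p <= mdeg b)%N -> dot p (Q b) = 0.
Proof.
move=> /Q_span[c ->]; rewrite L2dot_orthonormal_coef.
by case: insubP => // b'; rewrite ltnn.
Qed.

(** A polynomial of degree m orthogonal to the lower ones has zero coefficients
    on the Q a with mdeg a < m. *)
Lemma family_orthonormal_basis m :
  orthonormal_basis nu [ffun a : bmultinom d m.+1 => Q a].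
Proof.
split => [a am|a b _ _|p].
- rewrite ffunE; right; split; last first.
    by move=> q qm; rewrite L2dotC family_orthogonal_lower// am.
  have := Q_size a; rewrite am => Qm1.
  apply/eqP; rewrite eqn_leq Qm1 ltnNge; apply/negP => Qm.
  (* of smaller degree, Q a would be orthogonal to itself *)
  have := Q_ortho a a; rewrite family_orthogonal_lower ?am// eqxx => /eqP.
  by rewrite eq_sym oner_eq0.
- by rewrite !ffunE Q_ortho -bmeqP.
- case=> [->|[pm p_ortho]].
    by exists (fun=> 0); rewrite big1// => a _; rewrite scale0r.
  have [c pE] := Q_span (eq_leq pm); exists c.
  rewrite [LHS]pE (bigID (fun a : bmultinom d m.+1 => mdeg a == m))/=.
  rewrite [X in _ + X]big1 ?addr0.
    by apply: eq_bigr => a _; rewrite ffunE.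
  move=> a am; have := p_ortho (Q a); rewrite pE L2dot_orthonormal_coef valK.
  move=> ->; first by rewrite scale0r.
  by rewrite (leq_trans (Q_size a))// ltn_neqAle am -ltnS bmdeg.
Qed.

Lemma repr_kernelE m x y : repr_kernel nu m x y =
  \sum_(a : bmultinom d m.+1 | mdeg a == m) peval (Q a) x * peval (Q a) y.
Proof.
rewrite /repr_kernel; case: xgetP => [P _ oP|/(_ _ (family_orthonormal_basis m))//].
rewrite (kernel_basis_indep _ _ oP (family_orthonormal_basis m)).
by apply: eq_bigr => a _; rewrite ffunE.
Qed.

(** If p has coefficients c on Q and p(x) = 1, then by Cauchy-Schwarz
    1 = p(x)^2 <= (sum_a c_a^2) K, where K is the right-hand side and the first
    factor is the integral of p^2; equality holds for p = sum_a Q_a(x) Q_a / K. *)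
Lemma christoffelE n x :
  (christoffel nu n x)^-1 = \sum_(a : bmultinom d n.+1) peval (Q a) x ^+ 2.
Proof.
have dotQ (c : bmultinom d n.+1 -> R) :
    dot (\sum_(a : bmultinom d n.+1) c a *: Q a)
        (\sum_(a : bmultinom d n.+1) c a *: Q a) = \sum_a c a ^+ 2.
  rewrite L2dot_suml; apply: eq_bigr => a _.
  by rewrite L2dotC L2dot_orthonormal_coef valK expr2.
have evalQ (c : bmultinom d n.+1 -> R) :
    peval (\sum_(a : bmultinom d n.+1) c a *: Q a) x = \sum_a c a * peval (Q a) x.
  by rewrite peval_sum; under eq_bigr do rewrite pevalZ.
set K := RHS.
have K_ge0 : 0 <= K by apply: sumr_ge0 => a _; exact: sqr_ge0.
(* the sum of the (c_a - t Q_a(x))^2; t is 1 / K below, except to exclude K = 0 *)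
have quad (c : bmultinom d n.+1 -> R) t : \sum_a c a * peval (Q a) x = 1 ->
    0 <= (\sum_a c a ^+ 2) - 2 * t + t ^+ 2 * K.
  move=> c1.
  have : 0 <= \sum_a (c a - t * peval (Q a) x) ^+ 2.
    by apply: sumr_ge0 => a _; exact: sqr_ge0.
  suff -> : \sum_a (c a - t * peval (Q a) x) ^+ 2 =
      (\sum_a c a ^+ 2) - 2 * t * (\sum_a c a * peval (Q a) x) + t ^+ 2 * K.
    by rewrite c1 mulr1.
  rewrite /K !mulr_sumr -sumrB -big_split.
  by apply: eq_bigr => a _ /=; ring.
have K_gt0 : 0 < K.
  have [|c oneE] := @Q_span n.+1 1; first by rewrite msize1.
  have c1 : \sum_a c a * peval (Q a) x = 1.
    by rewrite -evalQ -oneE /peval meval1.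
  rewrite lt0r K_ge0 andbT; apply/eqP => K0.
  have S0 : 0 <= \sum_a c a ^+ 2 by apply: sumr_ge0 => a _; exact: sqr_ge0.
  by have := quad c (1 + \sum_a c a ^+ 2) c1; rewrite K0; lra.
have cauchy (c : bmultinom d n.+1 -> R) : \sum_a c a * peval (Q a) x = 1 ->
    K^-1 <= \sum_a c a ^+ 2.
  move=> /(quad _ K^-1); rewrite expr2 -mulrA mulVf ?mulr1 ?gt_eqF//.
  by lra.
suff -> : christoffel nu n x = K^-1 by rewrite invrK.
have min_in : [set dot p p | p in
    [set p | (msize p <= n.+1)%N /\ peval p x = 1]] K^-1.
  exists (\sum_(a : bmultinom d n.+1) (K^-1 * peval (Q a) x) *: Q a).
    split.
      apply: (leq_trans (mmeasure_sum _ _ _ _)); apply/bigmax_leqP => a _.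
      apply: (leq_trans (mmeasureZ_le _ _ _)); apply: (leq_trans (Q_size a)).
      exact: bmdeg.
    rewrite evalQ; under eq_bigr do rewrite -mulrA -expr2.
    by rewrite -mulr_sumr mulVf// gt_eqF.
  rewrite dotQ; under eq_bigr do rewrite exprMn.
  by rewrite -mulr_sumr expr2 -mulrA mulVf ?mulr1// gt_eqF.
have min_lb : lbound [set dot p p | p in
    [set p | (msize p <= n.+1)%N /\ peval p x = 1]] K^-1.
  move=> _ [p [pn px] <-]; have [c pE] := Q_span pn.
  by move: px; rewrite pE evalQ dotQ => /cauchy.
apply/eqP; rewrite eq_le; apply/andP; split.
  by apply: ge_inf => //; exists K^-1.
by apply: lb_le_inf => //; exists K^-1.
Qed.

End orthonormal_family.

(** * Orthonormal polynomials of the weighted equilibrium measures *)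

Section weighted_chebyshev.
Variables (R : realType) (d : nat).
Implicit Types (p : {mpoly R[d]}) (q : {poly R}) (a b m : multinom d).
Implicit Types (eps : {ffun 'I_d -> bool}) (x : Rd R d).

Definition poly_at (i : 'I_d) q : {mpoly R[d]} :=
  horner_alg (mpolyX R (mnm1 i)) q.

Lemma poly_atZ i c q : poly_at i (c *: q) = c *: poly_at i q.
Proof. by rewrite /poly_at linearZ /= mulr_algl. Qed.

Lemma poly_atD i q q' : poly_at i (q + q') = poly_at i q + poly_at i q'.
Proof. by rewrite /poly_at rmorphD. Qed.

Lemma poly_atXM i q : poly_at i ('X * q) = mpolyX R (mnm1 i) * poly_at i q.
Proof. by rewrite /poly_at rmorphM /= horner_algX. Qed.

Definition weighted_cheb eps a : {mpoly R[d]} :=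
  \prod_(i < d) poly_at i (ocheb R (eps i) (a i)).

Lemma peval_poly_at i q x : peval (poly_at i q) x = q.[tnth x i].
Proof.
rewrite /peval /poly_at; elim/poly_ind: q => [|q c IH].
  by rewrite !raddf0 horner0.
rewrite rmorphD rmorphM /= horner_algX horner_algC mevalD mevalM IH mevalXU.
by rewrite mevalZ meval1 mulr1 hornerMXaddC.
Qed.

Lemma peval_weighted_cheb eps a x :
  peval (weighted_cheb eps a) x =
  \prod_(i < d) (ocheb R (eps i) (a i)).[tnth x i].
Proof.
rewrite /peval rmorph_prod; apply: eq_bigr => i _; exact: peval_poly_at.
Qed.

Lemma integrable_peval eps p :
  (weighted_equilibrium eps).-integrable setT (EFin \o (fun x => peval p x)).
Proof.
elim/mpolyind: p => [|c m p _ _ IH].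
  have i0 := integrable0 (@weighted_equilibrium R d eps) setT.
  by move: i0; apply: eq_integrable => // x _; rewrite /= /peval meval0.
have [mi _] := weighted_equilibrium_prod eps (fun i => 'X^(m i) : {poly R}).
have := integrableD measurableT (integrableZl measurableT c mi) IH.
apply: eq_integrable => // x _ /=.
rewrite /peval mevalD mevalZ mevalX EFinD EFinM; congr (_ * _%:E + _)%E.
by apply: eq_bigr => i _; rewrite hornerXn.
Qed.

Lemma weighted_cheb_orthonormal eps a b :
  L2dot (weighted_equilibrium eps) (weighted_cheb eps a) (weighted_cheb eps b) =
  (a == b)%:R.
Proof.
have [_ intE] := weighted_equilibrium_prod eps
  (fun i => ocheb R (eps i) (a i) * ocheb R (eps i) (b i)).
rewrite /L2dot; transitivity (\int[weighted_equilibrium eps]_x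
    \prod_(i < d) (ocheb R (eps i) (a i) * ocheb R (eps i) (b i)).[tnth x i]).
  apply: eq_Rintegral => x _; rewrite !peval_weighted_cheb -big_split.
  by apply: eq_bigr => i _; rewrite hornerM.
rewrite intE; under eq_bigr do rewrite arcsine_mean_orthonormal.
have [<-|/eqP ab] := eqVneq a b; first by rewrite big1// => i _; rewrite eqxx.
have [i abi] : exists i, a i != b i.
  apply/existsP; rewrite -negb_forall; apply/negP => /forallP abE.
  by apply: ab; apply/mnmP => i; exact/eqP.
by apply/eqP/prodf_eq0; exists i => //; rewrite (negbTE abi).
Qed.

Let msizeM_deg p p' k l : (msize p <= k.+1)%N -> (msize p' <= l.+1)%N ->
  (msize (p * p') <= (k + l).+1)%N.
Proof.
have [->|p0] := eqVneq p 0; first by rewrite mul0r mmeasure0.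
have [->|p'0] := eqVneq p' 0; first by rewrite mulr0 mmeasure0.
move=> pk pl; rewrite msizeM//; have := leq_add pk pl; rewrite addSn addnS.
by case: (_ + _)%N.
Qed.

Let msize_mvarX (i : 'I_d) k : (msize (mpolyX R (mnm1 i) ^+ k) <= k.+1)%N.
Proof.
elim: k => [|k IH]; first by rewrite expr0 msize1.
by rewrite exprS; apply: (@msizeM_deg _ _ 1 k) => //; rewrite msizeX mdeg1.
Qed.

Let msize_poly_at i q k : (size q <= k.+1)%N -> (msize (poly_at i q) <= k.+1)%N.
Proof.
move=> qk; rewrite /poly_at -[q]coefK poly_def raddf_sum /=.
apply: (leq_trans (mmeasure_sum _ _ _ _)); apply/bigmax_leqP => j _.
rewrite linearZ /= mulr_algl; apply: (leq_trans (mmeasureZ_le _ _ _)).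
rewrite rmorphXn /= horner_algX (leq_trans (msize_mvarX _ _))//.
exact: leq_trans (ltn_ord j) qk.
Qed.

Lemma msize_weighted_cheb eps a : (msize (weighted_cheb eps a) <= (mdeg a).+1)%N.
Proof.
rewrite mdegE /weighted_cheb.
elim/big_rec2: _ => [|i k p _ pk]; first by rewrite msize1.
by apply: msizeM_deg => //; apply: msize_poly_at; exact: size_ocheb.
Qed.

Definition cheb_span eps n p :=
  exists c : bmultinom d n -> R,
    p = \sum_(a : bmultinom d n) c a *: weighted_cheb eps a.

Section span.
Variable eps : {ffun 'I_d -> bool}.
Notation span := (cheb_span eps).

Let spanD n p p' : span n p -> span n p' -> span n (p + p').
Proof.
move=> [c ->] [c' ->]; exists (fun a : bmultinom d n => c a + c' a).
by rewrite -big_split; apply: eq_bigr => a _; rewrite scalerDl.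
Qed.

Let spanZ n c p : span n p -> span n (c *: p).
Proof.
move=> [c' ->]; exists (fun a : bmultinom d n => c * c' a).
by rewrite scaler_sumr; apply: eq_bigr => a _; rewrite scalerA.
Qed.

Let span0 n : span n 0.
Proof. by exists (fun=> 0); rewrite big1// => a _; rewrite scale0r. Qed.

Let span_sum n (I : Type) (r : seq I) (P : pred I) F :
  (forall i, P i -> span n (F i)) -> span n (\sum_(i <- r | P i) F i).
Proof.
by move=> h; apply: (big_ind (span n)); [exact: span0|move=> *; exact: spanD|].
Qed.

Let span_cheb n a : (mdeg a < n)%N -> span n (weighted_cheb eps a).
Proof.
move=> an; exists (fun b : bmultinom d n => (a == b)%:R).
rewrite (bigD1 (BMultinom an))//= eqxx scale1r big1 ?addr0// => b.
rewrite bmeqP /= eq_sym => /negbTE ->.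
by rewrite scale0r.
Qed.

(* By the three-term recurrence in the variable of index i. *)
Let span_mulX n i p : span n p -> span n.+1 (mpolyX R (mnm1 i) * p).
Proof.
move=> [c ->]; rewrite mulr_sumr; apply: span_sum => a _.
rewrite -scalerAr; apply: spanZ.
have [s [t st]] := mulX_ocheb R (eps i) (a i).
suff -> : mpolyX R (mnm1 i) * weighted_cheb eps a =
    s *: weighted_cheb eps (mnm_add a (mnm1 i)) +
    t *: weighted_cheb eps (mnm_sub a (mnm1 i)).
  apply: spanD; apply: spanZ; apply: span_cheb.
    by rewrite mdegD mdeg1 addn1 ltnS bmdeg.
  by rewrite ltnS (leq_trans (mdegB _ _))// ltnW// bmdeg.
rewrite /weighted_cheb (bigD1 i)//= [in X in s *: X](bigD1 i)//=.
rewrite [in X in t *: X](bigD1 i)//=.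
have otherD : \prod_(j < d | j != i)
      poly_at j (ocheb R (eps j) (mnm_add a (mnm1 i) j)) =
    \prod_(j < d | j != i) poly_at j (ocheb R (eps j) (a j)).
  apply: eq_bigr => j ji.
  by rewrite mnmDE mnm1E eq_sym (negbTE ji) addn0.
have otherB : \prod_(j < d | j != i)
      poly_at j (ocheb R (eps j) (mnm_sub a (mnm1 i) j)) =
    \prod_(j < d | j != i) poly_at j (ocheb R (eps j) (a j)).
  apply: eq_bigr => j ji.
  by rewrite mnmBE mnm1E eq_sym (negbTE ji) subn0.
rewrite otherD otherB mnmDE mnmBE mnm1E eqxx addn1 subn1 !scalerAl -mulrDl mulrA.
by rewrite -poly_atXM st poly_atD !poly_atZ.
Qed.

Let span_monomial m : span (mdeg m).+1 (mpolyX R m).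
Proof.
have [n] := ubnP (mdeg m); elim: n => // n IH in m *; rewrite ltnS => mn.
have [m0|] := posnP (mdeg m).
  move/eqP: m0; rewrite mdeg_eq0 => /eqP ->; rewrite mpolyX0.
  (* the constant polynomial of the family is not 1 when some eps i is true *)
  pose c e : R := if e then Num.sqrt 2 else 1.
  have c0 e : c e != 0.
    by case: e; rewrite /c ?oner_neq0// sqrtr_eq0 -ltNge ltr0n.
  have oc e : ocheb R e 0 = (c e)%:P.
    by case: e; rewrite ?ocheb_false0// ocheb_true chebV1 -alg_polyC.
  have Q0 : weighted_cheb eps (@mnm0 d) = (\prod_i c (eps i)) *: 1.
    rewrite /weighted_cheb; elim/big_rec2: _ => [|i e p _ ->].
      by rewrite scale1r.
    by rewrite mnm0E oc /poly_at horner_algC -scalerAl mul1r scalerA.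
  have -> : 1 = (\prod_i c (eps i))^-1 *: weighted_cheb eps (@mnm0 d).
    by rewrite Q0 scalerA mulVf ?scale1r//; apply/prodf_neq0.
  by apply: spanZ; apply: span_cheb; rewrite mdeg0.
move=> mgt0.
have [i mi] : exists i, (0 < m i)%N.
  move: mgt0; rewrite mdegE lt0n sum_nat_eq0 negb_forall => /existsP[i].
  by rewrite implyTb -lt0n; exists i.
have mE : m = mnm_add (mnm1 i) (mnm_sub m (mnm1 i)).
  rewrite addmC submK//; apply/mnm_lepP => j; rewrite mnm1E.
  by case: eqP => // <-.
have degE : mdeg m = (mdeg (mnm_sub m (mnm1 i))).+1.
  by rewrite {1}mE mdegD mdeg1 add1n.
rewrite mE mpolyXD -mE degE; apply: span_mulX; apply: IH.
by rewrite -ltnS -degE.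
Qed.

Let span_widen k n p : (k <= n)%N -> span k p -> span n p.
Proof.
move=> kn [c ->]; apply: span_sum => a _; apply: spanZ; apply: span_cheb.
exact: leq_trans (bmdeg a) kn.
Qed.

Lemma weighted_cheb_span n p : (msize p <= n)%N -> span n p.
Proof.
move=> pn; rewrite [p]mpolyE big_seq; apply: span_sum => m mp; apply: spanZ.
apply: span_widen (span_monomial m); apply: leq_trans pn.
exact: msize_mdeg_lt.
Qed.
End span.

End weighted_chebyshev.

(** * Sums over weights and multidegrees *)

Section sums_over_multidegrees.
Variables (d : nat).
Implicit Types (m : multinom d).

(** A list rather than a predicate on the multi-indices of bounded degree: the
    bound on the degree changes when a weight eps is added to a multi-index. *)
Definition degree_mnms k : seq (multinom d) :=
  [seq bmnm a | a : bmultinom d k.+1 <- index_enum (bmultinom d k.+1) & mdeg a == k].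

Lemma uniq_degree_mnms k : uniq (degree_mnms k).
Proof.
by rewrite map_inj_in_uniq ?filter_uniq ?index_enum_uniq// => a b _ _; exact: val_inj.
Qed.

Lemma mem_degree_mnms k m : (m \in degree_mnms k) = (mdeg m == k).
Proof.
apply/mapP/eqP => [[a + ->]|mk]; first by rewrite mem_filter => /andP[/eqP].
have mlt : (mdeg m < k.+1)%N by rewrite mk.
by exists (BMultinom mlt) => //; rewrite mem_filter mem_index_enum /= mk eqxx.
Qed.

Lemma big_degree_mnms (R : nmodType) k (F : multinom d -> R) :
  \sum_(a : bmultinom d k.+1 | mdeg a == k) F a = \sum_(m <- degree_mnms k) F m.
Proof. by rewrite big_map big_filter. Qed.

Lemma big_bmultinom_degree (R : nmodType) n (F : multinom d -> R) :
  \sum_(a : bmultinom d n.+1) F a =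
  \sum_(k < n.+1) \sum_(m <- degree_mnms k) F m.
Proof.
rewrite (partition_big (fun a : bmultinom d n.+1 => Ordinal (bmdeg a)) predT)//=.
apply: eq_bigr => k _.
transitivity (\sum_(m <- [seq bmnm a |
    a : bmultinom d n.+1 <- index_enum (bmultinom d n.+1) & mdeg a == k]) F m).
  by rewrite big_map big_filter.
apply/perm_big/uniq_perm; last 2 first.
- exact: uniq_degree_mnms.
- move=> m; rewrite mem_degree_mnms; apply/mapP/eqP => [[a + ->]|mk].
    by rewrite mem_filter => /andP[/eqP].
  have mlt : (mdeg m < n.+1)%N by rewrite mk ltn_ord.
  by exists (BMultinom mlt) => //; rewrite mem_filter mem_index_enum /= mk eqxx.
by rewrite map_inj_in_uniq ?filter_uniq ?index_enum_uniq// => a b _ _; exact: val_inj.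
Qed.

Definition mnm_eps (eps : {ffun 'I_d -> bool}) : multinom d :=
  Multinom [tuple eps i : nat | i < d].

Lemma mnm_epsE eps i : mnm_eps eps i = eps i.
Proof. exact: mnmE. Qed.

Lemma mdeg_mnm_eps eps : mdeg (mnm_eps eps) = (\sum_(i < d) eps i)%N.
Proof. by rewrite mdegE; apply: eq_bigr => i _; rewrite mnm_epsE. Qed.

Lemma big_degree_mnms_shift (R : nmodType) k e (F : multinom d -> R) :
  (mdeg e <= k)%N ->
  \sum_(m <- degree_mnms k | mpoly.lem e m) F (mnm_sub m e) =
  \sum_(m <- degree_mnms (k - mdeg e)) F m.
Proof.
move=> ek; transitivity (\sum_(m <- [seq mnm_add m e | m <- degree_mnms (k - mdeg e)])
    F (mnm_sub m e)); last first.
  by rewrite big_map; apply: eq_bigr => m _; rewrite addmK.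
rewrite -big_filter; apply/perm_big/uniq_perm.
- by rewrite filter_uniq// uniq_degree_mnms.
- by rewrite map_inj_uniq ?uniq_degree_mnms//; exact: addIm.
move=> m; rewrite mem_filter mem_degree_mnms.
apply/andP/mapP => [[em /eqP mk]|[m' + ->]].
  exists (mnm_sub m e); last by rewrite submK.
  rewrite mem_degree_mnms -mk -{2}(submK em) mdegD addnK//.
rewrite mem_degree_mnms => /eqP m'k; split; first exact: lem_addl.
by rewrite mdegD m'k subnK.
Qed.

(** For a fixed b = a + eps, the choice of eps is made in each coordinate
    independently, so the sum over eps is an expanded product of sums over the
    at most two ways of writing b_i as eps_i + a_i. *)
Lemma sum_eps_mnms (R : comNzRingType) (f : 'I_d -> bool -> nat -> R) k :
  \sum_(eps : {ffun 'I_d -> bool} | (\sum_(j < d) eps j <= k)%N)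
    \sum_(a <- degree_mnms (k - \sum_(j < d) eps j)) \prod_(i < d) f i (eps i) (a i)
  = \sum_(b <- degree_mnms k) \prod_(i < d)
      \sum_(e : bool | (e <= b i)%N) f i e (b i - e)%N.
Proof.
transitivity (\sum_(b <- degree_mnms k)
    \sum_(eps : {ffun 'I_d -> bool} | mpoly.lem (mnm_eps eps) b)
      \prod_(i < d) f i (eps i) (b i - eps i)%N); last first.
  apply: eq_bigr => b _; rewrite bigA_distr_big_dep.
  apply: eq_bigl => eps; apply/mnm_lepP/familyP => h i.
    by have := h i; rewrite mnm_epsE.
  by rewrite mnm_epsE; exact: h.
rewrite [RHS](exchange_big_dep predT)//=.
rewrite [RHS](bigID (fun eps : {ffun 'I_d -> bool} => (\sum_(j < d) eps j <= k)%N))/=.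
rewrite [X in _ = _ + X]big1 ?addr0 => [|eps epsk]; last first.
  rewrite big_seq_cond big1// => b /andP[]; rewrite mem_degree_mnms => /eqP bk eb.
  move: epsk; rewrite -mdeg_mnm_eps -bk -(submK eb) mdegD leq_addl//.
apply: eq_bigr => eps epsk; rewrite -mdeg_mnm_eps in epsk *.
rewrite -(big_degree_mnms_shift (fun a => \prod_(i < d) f i (eps i) (a i)) epsk).
by apply: eq_bigr => b _; apply: eq_bigr => i _; rewrite mnmBE mnm_epsE.
Qed.

(** The sum sees f only through the factors of sum_eps_mnms, that is through
    f_i(0, 0) and f_i(0, n + 1) + f_i(1, n). *)
Lemma eq_sum_eps_mnms (R : comNzRingType) (f g : 'I_d -> bool -> nat -> R) k :
    (forall i, f i false 0%N = g i false 0%N) ->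
    (forall i n, f i false n.+1 + f i true n = g i false n.+1 + g i true n) ->
  \sum_(eps : {ffun 'I_d -> bool} | (\sum_(j < d) eps j <= k)%N)
    \sum_(a <- degree_mnms (k - \sum_(j < d) eps j)) \prod_(i < d) f i (eps i) (a i)
  = \sum_(eps : {ffun 'I_d -> bool} | (\sum_(j < d) eps j <= k)%N)
    \sum_(a <- degree_mnms (k - \sum_(j < d) eps j)) \prod_(i < d) g i (eps i) (a i).
Proof.
move=> fg0 fgS; rewrite !sum_eps_mnms; apply: eq_bigr => b _.
apply: eq_bigr => i _.
rewrite !(big_mkcond (fun e : bool => (e <= b i)%N)) !big_bool /=.
case: (b i) => [|n].
  by rewrite !add0r subn0 fg0.
by rewrite !subn0 subn1 /= addrC fgS addrC.
Qed.

End sums_over_multidegrees.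

(** A multi-index of degree k is a nondecreasing sequence of k indices, each
    index being repeated according to its exponent. *)
Lemma size_degree_mnms n k : size (degree_mnms n.+1 k) = 'C(k + n, k).
Proof.
rewrite -size_basis; apply/perm_size/uniq_perm.
- exact: uniq_degree_mnms.
- exact: uniq_basis.
- by move=> m; rewrite mem_degree_mnms basis_cover.
Qed.

Lemma card_bool_ffun_sum d j :
  #|[pred eps : {ffun 'I_d -> bool} | (\sum_(i < d) eps i)%N == j]| = 'C(d, j).
Proof.
pose indic (A : {set 'I_d}) := [ffun i => i \in A].
have indic_inj : injective indic.
  by move=> A B /ffunP AB; apply/setP => i; have := AB i; rewrite !ffunE.
have := card_draws 'I_d j; rewrite card_ord => <-; rewrite -(card_imset _ indic_inj).
apply: eq_card => eps; rewrite !inE; apply/eqP/imsetP => [epsj|[A + ->]].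
  exists [set i | eps i]%SET; last by apply/ffunP => i; rewrite ffunE inE.
  rewrite inE -epsj -sum1_card big_mkcond /=; apply/eqP/eq_bigr => i _.
  by rewrite inE; case: (eps i).
rewrite inE => /eqP <-; rewrite -sum1_card [RHS]big_mkcond /=.
by apply: eq_bigr => i _; rewrite ffunE; case: (i \in A).
Qed.

Section kernel_sum.
Variables (R : realType) (d : nat).
Hypothesis d_ge1 : (1 <= d)%N.
Implicit Types (eps : {ffun 'I_d -> bool}) (x : Rd R d).

Lemma repr_kernel_weighted_equilibrium eps k x y :
  repr_kernel (weighted_equilibrium eps) k x y =
  \sum_(a <- degree_mnms d k)
    peval (weighted_cheb R eps a) x * peval (weighted_cheb R eps a) y.
Proof.
rewrite (repr_kernelE (@integrable_peval R d eps)
  (weighted_cheb_orthonormal R eps) (msize_weighted_cheb R eps)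
  (weighted_cheb_span eps)).
exact: big_degree_mnms.
Qed.

Lemma christoffel_weighted_equilibrium eps n x :
  (christoffel (weighted_equilibrium eps) n x)^-1 =
  \sum_(k < n.+1) repr_kernel (weighted_equilibrium eps) k x x.
Proof.
rewrite (christoffelE (@integrable_peval R d eps)
  (weighted_cheb_orthonormal R eps) (msize_weighted_cheb R eps)
  (weighted_cheb_span eps)).
rewrite (big_bmultinom_degree _ (fun a => peval (weighted_cheb R eps a) x ^+ 2)).
by apply: eq_bigr => k _; rewrite repr_kernel_weighted_equilibrium.
Qed.

(** Pascal's rule. The truncation in d + m - 1 - j is harmless for j <= m, as
    d is positive. *)
Lemma size_degree_mnms_binB j m : (j <= m)%N ->
  (size (degree_mnms d (m - j)))%:R =
  'C(d + m - j, d)%:R - 'C(d + m - 1 - j, d)%:R :> R.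
Proof.
case: d d_ge1 => // n _ jm; rewrite size_degree_mnms.
have -> : (n.+1 + m - j = (m - j + n).+1)%N by lia.
have -> : (n.+1 + m - 1 - j = m - j + n)%N by lia.
rewrite binS natrD addrAC subrr add0r -(@bin_sub _ (m - j)) ?leq_addr//.
by rewrite addKn.
Qed.

(** The pairs (eps, a) with |eps| + |a| = m, sorted by j = |eps|. *)
Lemma sum_eps_mnms_card m :
  \sum_(eps : {ffun 'I_d -> bool} | (\sum_(j < d) eps j <= m)%N)
    (size (degree_mnms d (m - \sum_(j < d) eps j)))%:R =
  \sum_(j < d.+1) 'C(d, j)%:R *
    ('C(d + m - j, d)%:R - 'C(d + m - 1 - j, d)%:R) :> R.
Proof.
have epsd eps : (\sum_(j < d) eps j < d.+1)%N.
  rewrite ltnS -[X in (_ <= X)%N]card_ord -sum1_card.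
  by apply: leq_sum => i _; case: (eps i).
rewrite (partition_big (fun eps => Ordinal (epsd eps)) predT)//=.
apply: eq_bigr => j _.
have [jm|mj] := leqP j m; last first.
  rewrite big1 => [|eps /andP[em /eqP epsj]]; last first.
    by rewrite -epsj /= ltnNge em in mj.
  (* no weight eps of that size occurs, and both binomials vanish *)
  have lt1 : (d + m - j < d)%N by lia.
  have lt2 : (d + m - 1 - j < d)%N by lia.
  by rewrite (bin_small lt1) (bin_small lt2) subrr mulr0.
rewrite -size_degree_mnms_binB// mulr_natl -(card_bool_ffun_sum d j) -sumr_const.
apply: eq_big => [eps|eps /andP[_ /eqP <-]//].
rewrite inE -val_eqE /=; case: eqP => [->|_]; last by rewrite andbF.
by rewrite jm.
Qed.

(** By ocheb_pell the kernels enter sum_eps_mnms through factors 1 and 2, the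
    same as for the constant function 1, which counts the pairs (eps, a). *)
Lemma sum_repr_kernel m x :
  \sum_(eps : {ffun 'I_d -> bool} | (\sum_(j < d) eps j <= m)%N)
     cube_weight eps x *
     repr_kernel (weighted_equilibrium eps) (m - \sum_(j < d) eps j) x x =
  \sum_(j < d.+1) 'C(d, j)%:R *
     ('C(d + m - j, d)%:R - 'C(d + m - 1 - j, d)%:R).
Proof.
pose f (i : 'I_d) (e : bool) k : R :=
  (1 - tnth x i ^+ 2) ^+ e * (ocheb R e k).[tnth x i] ^+ 2.
rewrite -sum_eps_mnms_card.
transitivity (\sum_(eps : {ffun 'I_d -> bool} | (\sum_(j < d) eps j <= m)%N)
    \sum_(a <- degree_mnms d (m - \sum_(j < d) eps j)) \prod_(i < d) f i (eps i) (a i)).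
  apply: eq_bigr => eps _; rewrite repr_kernel_weighted_equilibrium mulr_sumr.
  apply: eq_bigr => a _; rewrite peval_weighted_cheb /cube_weight -!big_split.
  by apply: eq_bigr => i _; rewrite /f expr2.
rewrite (@eq_sum_eps_mnms _ _ f (fun _ _ _ => 1)) => [|i|i n].
- apply: eq_bigr => eps _; under eq_bigr do rewrite big1//.
  by rewrite big_const_seq count_predT iter_addr_0.
- by rewrite /f ocheb_false0 hornerC expr0 expr1n mulr1.
- by rewrite /f expr0 mul1r expr1 ocheb_pell.
Qed.

(** The inverse Christoffel function of degree n - |eps| is the sum of the
    kernels of degree m - |eps| over |eps| <= m <= n; after exchanging the sums,
    the right-hand sides of sum_repr_kernel telescope. *)
Lemma sum_christoffel n x :
  \sum_(eps : {ffun 'I_d -> bool} | (\sum_(j < d) eps j <= n)%N)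
     cube_weight eps x *
     (christoffel (weighted_equilibrium eps) (n - \sum_(j < d) eps j) x)^-1 =
  \sum_(j < d.+1) 'C(d, j)%:R * 'C(d + n - j, d)%:R.
Proof.
transitivity (\sum_(m < n.+1)
  \sum_(eps : {ffun 'I_d -> bool} | (\sum_(j < d) eps j <= m)%N)
     cube_weight eps x *
     repr_kernel (weighted_equilibrium eps) (m - \sum_(j < d) eps j) x x).
  rewrite [RHS](exchange_big_dep
    (fun eps : {ffun 'I_d -> bool} => \sum_(j < d) eps j <= n)%N)/=; last first.
    by move=> m eps _ em; rewrite (leq_trans em)// -ltnS.
  apply: eq_bigr => eps en; rewrite -mulr_sumr christoffel_weighted_equilibrium.
  congr (_ * _); set s := (\sum_(j < d) eps j)%N in en *.
  rewrite -(big_mkord xpredT (fun k => repr_kernel (weighted_equilibrium eps) k x x)).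
  rewrite -(big_mkord (fun m => (s <= m)%N)
    (fun m => repr_kernel (weighted_equilibrium eps) (m - s) x x)).
  transitivity (\sum_(s <= m < n.+1)
      repr_kernel (weighted_equilibrium eps) (m - s) x x); last first.
    by rewrite (big_nat_widenl s 0).
  rewrite -subSn// -{2}[s]add0n big_addn.
  by apply: eq_bigr => k _; rewrite addnK.
under eq_bigr do rewrite sum_repr_kernel.
rewrite exchange_big; apply: eq_bigr => j _ /=; rewrite -mulr_sumr; congr (_ * _).
rewrite -(big_mkord xpredT (fun m => 'C(d + m - j, d)%:R - 'C(d + m - 1 - j, d)%:R)).
have tele m : 'C(d + m - j, d)%:R - 'C(d + m - 1 - j, d)%:R =
    'C(d + m.+1 - 1 - j, d)%:R - 'C(d + m - 1 - j, d)%:R :> R.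
  by congr (_%:R - _); congr ('C(_, _)); lia.
under eq_bigr do rewrite tele.
rewrite (telescope_sumr (fun m => 'C(d + m - 1 - j, d)%:R))//.
rewrite addn0 [X in _ - X%:R]bin_small ?subr0; last by lia.
by congr (('C(_, _))%:R); lia.
Qed.

End kernel_sum.

Theorem theorem4p5 (R : realType) (d : nat) (d_ge1 : (1 <= d)%N) :
  (forall (m : nat) (x : Rd R d),
     \sum_(eps : {ffun 'I_d -> bool} | (\sum_(j < d) eps j <= m)%N)
        cube_weight eps x *
        repr_kernel (weighted_equilibrium eps) (m - \sum_(j < d) eps j) x x =
     \sum_(j < d.+1) 'C(d, j)%:R *
        ('C(d + m - j, d)%:R - 'C(d + m - 1 - j, d)%:R)) /\
  (forall (n : nat) (x : Rd R d),
     \sum_(eps : {ffun 'I_d -> bool} | (\sum_(j < d) eps j <= n)%N)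
        cube_weight eps x *
        (christoffel (weighted_equilibrium eps) (n - \sum_(j < d) eps j) x)^-1 =
     \sum_(j < d.+1) 'C(d, j)%:R * 'C(d + n - j, d)%:R).
Proof. by split => n x; [exact: sum_repr_kernel|exact: sum_christoffel]. Qed.
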